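(* Let $G(V,E)$ be a connected trivalent graph and let $\Gamma$ be a ribbon graph of it. Let $n\in\mathbb{N}$ (positive integer) and let $\mathbb{k}$ be a ring in which $\sqrt n$ is defined. Then the bigraded $n$-color vertex homology $VCH_n^{*,*}(\Gamma;\mathbb{k})$ is an invariant of the ribbon graph $\Gamma$. Furthermore, its graded Euler characteristic is the $n$-color vertex polynomial: $$\langle\!\langle \Gamma\rangle\!\rangle_n=\chi_q\big(VCH_n^{*,*}(\Gamma;\mathbb{k})\big).$$
   Context: Graphs are finite multigraphs: loops and multiple edges are allowed, and so are ''vertex-less'' edges (circles, also regarded as loops). Trivalent means every vertex has degree 3 (a loop at a vertex counts twice). Ribbon graphs. A ribbon graph $\Gamma$ of $G$ is a surface with boundary in which $G$ is embedded and which deformation retracts onto $G$. Combinatorially it is given by a cyclic ordering of the half-edges at each vertex and a sign for each edge: take a disc for each vertex, glue bands for the edges according to the cyclic orders, and insert a half-twist in the band of each negative edge (a vertex-less edge gives an annulus or Möbius band). Capping the boundary circles by discs gives a closed surface $\overline\Gamma$. Two ribbon graphs $\Gamma_1,\Gamma_2$ of $G_1,G_2$ are equivalent if there is a homeomorphism $\overline\Gamma_1\to\overline\Gamma_2$ inducing a graph isomorphism $G_1\to G_2$. Being an invariant of the ribbon graph means that, up to isomorphism, the homology does not depend on the ordering of the vertices or on the diagram used to present $\Gamma$. States. Let $H$ be the set of half-edges of $G$ (pairs of an edge and one of its ends at a vertex). For $\alpha\in\{0,1\}^H$, $\Gamma_\alpha$ is the ribbon graph obtained from $\Gamma$ by inserting,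 for each half-edge $h$ with $\alpha_h=1$, one half-twist in the band of the edge containing $h$ (two half-twists in one band cancel). For $\nu\in\{0,1\}^V$ let $\alpha(\nu)_h=\nu_v$ where $v$ is the vertex of $h$, and $\Gamma_\nu:=\Gamma_{\alpha(\nu)}$ (so a ''vertex 1-smoothing'' at $v$ half-twists all three bands at $v$). The circles of a state are its boundary circles; $k_\nu$ is their number for $\Gamma_\nu$; $|\nu|=\sum_v\nu_v$, $|\alpha|=\sum_h\alpha_h$. Polynomial. Let $m=n/2$ if $n$ is even and $m=(n-1)/2$ if $n$ is odd. Let $L_n(q)=\sum_{k=0}^{n-1}q^{m-k}$. The $n$-color vertex polynomial is $\langle\!\langle\Gamma\rangle\!\rangle_n(q)=\sum_{\nu\in\{0,1\}^V}(-1)^{|\nu|}q^{3m|\nu|}L_n(q)^{k_\nu}$. Homology. Let $A=\mathbb{k}[x]/(x^n)$, graded by $\deg x^k=m-k$, with maps $\mu(x^i\otimes x^j)=x^{i+j}$ if $i+j<n$ and $0$ otherwise; $\Delta(x^k)=\sum_{0\le i,j<n,\ i+j=k+2m}x^i\otimes x^j$; $\eta(x^k)=\sqrt n\,x^{k+m}$ if $k+m<n$ and $0$ otherwise. To $\Gamma_\alpha$ associate $A_\alpha=A^{\otimes(\text{circles of }\Gamma_\alpha)}$ with degrees shifted up by $m|\alpha|$. If $\alpha'$ is obtained from $\alpha$ by changing one coordinate from 0 to 1, inserting the half-twist either merges two circles into one, splits one circle into two, or changes one circle into one circle; $\partial_{\alpha\alpha'}:A_\alpha\to A_{\alpha'}$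 applies $\mu$, $\Delta$, $\eta$ respectively on the factors of the affected circles and the identity on the others. If $\nu'$ is obtained from $\nu$ by changing one coordinate $v$ from 0 to 1, $\delta_{\nu\nu'}:A_{\alpha(\nu)}\to A_{\alpha(\nu')}$ is the composition of three maps $\partial$ along any of the six 3-step paths from $\alpha(\nu)$ to $\alpha(\nu')$ (the composition is independent of the path). Order $V=\{v_1,\dots,v_{|V|}\}$. Let $C_n^{i,j}(\Gamma)$ be the degree $j$ part of $\bigoplus_{|\nu|=i}A_{\alpha(\nu)}$ and, on the summand of $\nu$, $\delta=\sum_{\nu'}(-1)^{s}\delta_{\nu\nu'}$, where $s$ is the number of 1's of $\nu$ in positions before the changed coordinate. Then $VCH_n^{i,j}(\Gamma;\mathbb{k})$ is the homology of $(C_n^{*,j}(\Gamma),\delta)$ at $i$. Graded Euler characteristic. For a graded module $W=\bigoplus_j W^j$ the graded (quantum) dimension is $q\dim W=\sum_j q^j\dim W^j$, and $\chi_q(VCH_n^{*,*}(\Gamma;\mathbb{k}))=\sum_i(-1)^i\,q\dim VCH_n^{i,*}(\Gamma;\mathbb{k})$. *)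

(* Defs.v *)
From HB Require Import structures.
From mathcomp Require Import all_boot all_order all_algebra.
From mathcomp Require Import perm.
From mathcomp Require Import boolp classical_sets fsbigop.

Set Implicit Arguments.
Unset Strict Implicit.
Unset Printing Implicit Defensive.

Import Order.TTheory GRing.Theory Num.Theory.
Local Open Scope ring_scope.
Local Open Scope quotient_scope.

(** * Multigraphs and ribbon graphs *)

(* An edge with ends is an orbit {h, opp h} of half-edges; loops and multiple
   edges are thus allowed.  [circle_edge] is the set of vertex-less edges. *)
Record multigraph := Multigraph {
  vertex : finType;
  half_edge : finType;
  circle_edge : finType;
  vert : half_edge -> vertex;
  opp : half_edge -> half_edge;
  oppK : involutive opp;
  opp_neq : forall h, opp h != h }.

Definition star (G : multigraph) (v : vertex G) : {set half_edge G} :=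
  [set h | vert h == v].

Definition trivalent (G : multigraph) : Prop :=
  forall v : vertex G, #|star v| = 3%N.

(* The connected components of G are those of this relation: a vertex-less edge
   is a component by itself. *)
Definition adjacent (G : multigraph) : rel (vertex G + circle_edge G) :=
  fun x y => match x, y with
  | inl u, inl v => [exists h : half_edge G, (vert h == u) && (vert (opp h) == v)]
  | _, _ => false
  end.

Definition connected (G : multigraph) : Prop :=
  (0 < #|{: vertex G + circle_edge G}|)%N /\
  forall x y, connect (@adjacent G) x y.

(* [cyc_next h] follows h in the cyclic ordering around [vert h]; the two
   conditions on it say that its orbits are exactly the stars.  [neg h] says that
   the edge {h, opp h} has sign -1, and [cneg c] that c gives a Moebius band. *)
Record ribbon (G : multigraph) := Ribbon {
  cyc_next : {perm half_edge G};
  cyc_next_vert : forall h, vert (cyc_next h) = vert h;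
  cyc_next_trans : forall h h', vert h = vert h' -> h' \in porbit cyc_next h;
  neg : half_edge G -> bool;
  neg_opp : forall h, neg (opp h) = neg h;
  cneg : circle_edge G -> bool }.

(* Every half-edge, and every vertex-less edge, has two sides.  For a half-edge
   they are its left (true) and right (false) sides, looking outwards from its
   vertex, the cyclic ordering being counterclockwise. *)
Definition side (G : multigraph) : finType :=
  ((half_edge G + circle_edge G) * bool)%type.

Definition state (G : multigraph) : finType := {ffun half_edge G -> bool}.

Section Circles.
Variables (G : multigraph) (Gamma : ribbon G).

(* The arc of boundary on a vertex disc between two consecutive bands. *)
Definition corner (x : side G) : side G :=
  match x with
  | (inl h, true) => (inl (cyc_next Gamma h), false)
  | (inl h, false) => (inl ((cyc_next Gamma)^-1%g h), true)
  | (inr c, b) => (inr c, b)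
  end.

Definition twisted (alpha : state G) (h : half_edge G) : bool :=
  neg Gamma h (+) alpha h (+) alpha (opp h).

(* The arc of boundary along a band of Gamma_alpha.  An untwisted band joins the
   left side at one end to the right side at the other end.  The two sides of a
   vertex-less edge form two circles (annulus) or one (Moebius band). *)
Definition band (alpha : state G) (x : side G) : side G :=
  match x with
  | (inl h, b) => (inl (opp h), b (+) ~~ twisted alpha h)
  | (inr c, b) => (inr c, b (+) cneg Gamma c)
  end.

Definition arc (alpha : state G) : rel (side G) :=
  fun x y => (y == corner x) || (y == band alpha x).

(* The boundary circles of Gamma_alpha.  (A vertex of degree 0 would contribute
   another circle; there is none in a trivalent graph.) *)
Definition circles (alpha : state G) : {set {set side G}} :=
  [set [set y | connect (arc alpha) x y] | x in [set: side G]].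

Definition circle (alpha : state G) : finType :=
  {c : {set side G} | c \in circles alpha}.

Definition vstate (nu : {ffun vertex G -> bool}) : state G :=
  [ffun h => nu (vert h)].

End Circles.

Definition state0 (G : multigraph) : state G := [ffun => false].

Definition weight (T : finType) (a : {ffun T -> bool}) : nat := \sum_x a x.

(** * Equivalence of ribbon graphs *)

(* A homeomorphism of the capped-off surfaces which induces an isomorphism of
   the graphs is recorded, up to isotopy, by the graph isomorphism (fV, fH, fC)
   and by the bijection fS that it induces on the sides of the (half-)edges,
   which preserves the corners at the vertices and the arcs along the edges.
   Corners may be preserved or reversed, so that the local orientation at a
   vertex need not be preserved. *)
Definition ribbon_equiv (G1 G2 : multigraph)
    (Gamma1 : ribbon G1) (Gamma2 : ribbon G2) : Prop :=
  exists (fV : vertex G1 -> vertex G2) (fH : half_edge G1 -> half_edge G2)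
         (fC : circle_edge G1 -> circle_edge G2) (fS : side G1 -> side G2),
    [/\ [/\ bijective fV, bijective fH, bijective fC & bijective fS],
        (forall h, vert (fH h) = fV (vert h)) /\
        (forall h, opp (fH h) = fH (opp h)),
        forall x, (fS x).1 =
          match x.1 with inl h => inl (fH h) | inr c => inr (fC c) end,
        forall x, fS (corner Gamma1 x) = corner Gamma2 (fS x)
      & forall x, fS (band Gamma1 (state0 G1) x) =
                  band Gamma2 (state0 G2) (fS x)].

(** * Homology *)

Section QuotientModule.
Variables (k : pzRingType) (M : lmodType k) (N : submodClosed M).

(* Quotients in the library are taken by a [zmodClosed] predicate. *)
Definition zmod_of : M -> bool := fun x => x \in N.
Fact zmod_of_closed : subsemimod_closed zmod_of.
Proof.
by do ?split; [exact: rpred0|exact: rpredD|move=> a x; exact: rpredZ].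
Qed.
HB.instance Definition _ := GRing.isSubmodClosed.Build k M zmod_of zmod_of_closed.
Definition zmod_of_pred : zmodClosed M := GRing.ZmodClosed.clone M zmod_of _.

Definition quot_lmod : Type := Quotient.quot zmod_of_pred.
HB.instance Definition _ := GRing.Zmodule.on quot_lmod.

Definition quot_scale (a : k) (x : quot_lmod) : quot_lmod :=
  \pi_(Quotient.quot zmod_of_pred) (a *: (repr x : M)).

Fact pi_quot_scale a (x : M) :
  quot_scale a (\pi_(Quotient.quot zmod_of_pred) x) =
  \pi_(Quotient.quot zmod_of_pred) (a *: x).
Proof.
rewrite /quot_scale; apply/eqP; rewrite -Quotient.idealrBE -scalerBr.
by apply: rpredZ; rewrite Quotient.idealrBE reprK.
Qed.

Fact quot_lmodW (P : quot_lmod -> Prop) :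
  (forall x : M, P (\pi_(Quotient.quot zmod_of_pred) x)) -> forall y, P y.
Proof. by move=> Ppi y; rewrite -[y](@reprK _ (Quotient.quot zmod_of_pred)). Qed.

Fact quot_piD (x y : M) : \pi_(Quotient.quot zmod_of_pred) (x + y) =
  (\pi_(Quotient.quot zmod_of_pred) x + \pi_(Quotient.quot zmod_of_pred) y : quot_lmod).
Proof. exact: raddfD. Qed.

Fact quot_scaleA a b x : quot_scale a (quot_scale b x) = quot_scale (a * b) x.
Proof. by elim/quot_lmodW: x => x; rewrite !pi_quot_scale scalerA. Qed.
Fact quot_scale1 : left_id 1 quot_scale.
Proof. by elim/quot_lmodW=> x; rewrite pi_quot_scale scale1r. Qed.
Fact quot_scaleDr : right_distributive quot_scale +%R.
Proof.
move=> a x y; elim/quot_lmodW: x => x; elim/quot_lmodW: y => y.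
by rewrite -quot_piD !pi_quot_scale -quot_piD scalerDr.
Qed.
Fact quot_scaleDl x : {morph quot_scale^~ x : a b / a + b}.
Proof.
by move=> a b; elim/quot_lmodW: x => x; rewrite !pi_quot_scale -quot_piD scalerDl.
Qed.

HB.instance Definition _ := GRing.Zmodule_isLmodule.Build k quot_lmod
  quot_scaleA quot_scale1 quot_scaleDr quot_scaleDl.
End QuotientModule.

(* The homology at C of  C' --d--> C --d--> W,  where C' and C are submodules of
   a module W with an endomorphism d: the cycles in C modulo those which are
   boundaries of elements of C'. *)
Section Homology.
Variables (k : pzRingType) (W : lmodType k) (d : {linear W -> W}).
Variables (C' C : submodClosed W).

Definition is_cycle : W -> bool := fun w => (w \in C) && (d w == 0).
Fact is_cycle_closed : subsemimod_closed is_cycle.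
Proof.
split; first split.
- by apply/andP; rewrite rpred0 linear0.
- move=> x y /andP[Cx /eqP dx] /andP[Cy /eqP dy]; apply/andP.
  by rewrite rpredD // linearD dx dy addr0.
- move=> a x /andP[Cx /eqP dx]; apply/andP.
  by rewrite rpredZ // linearZ /= dx scaler0.
Qed.
HB.instance Definition _ := GRing.isSubmodClosed.Build k W is_cycle is_cycle_closed.

Definition cycle_lmod : Type := {w : W | is_cycle w}.
HB.instance Definition _ := [isSub of cycle_lmod for @sval W is_cycle].
HB.instance Definition _ := [Choice of cycle_lmod by <:].
HB.instance Definition _ := [SubChoice_isSubLmodule of cycle_lmod by <:].

Definition is_boundary : cycle_lmod -> bool :=
  fun z => `[< exists2 w, w \in C' & d w = \val z >].
Fact is_boundary_closed : subsemimod_closed is_boundary.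
Proof.
split; first split.
- by apply/asboolP; exists 0; rewrite ?rpred0 ?linear0.
- move=> x y /asboolP[u Cu du] /asboolP[v Cv dv]; apply/asboolP.
  by exists (u + v); [exact: rpredD | rewrite linearD du dv].
- move=> a x /asboolP[u Cu du]; apply/asboolP.
  by exists (a *: u); [exact: rpredZ | rewrite linearZ /= du].
Qed.
HB.instance Definition _ :=
  GRing.isSubmodClosed.Build k cycle_lmod is_boundary is_boundary_closed.

Definition homology : lmodType k :=
  quot_lmod (GRing.SubmodClosed.clone k cycle_lmod is_boundary _).
End Homology.

(** * The vertex homology *)

Definition half_color (n : nat) : nat := n./2.

Section VertexHomology.
Variables (G : multigraph) (Gamma : ribbon G) (n : nat).
Variables (k : comNzRingType) (sqrtn : k).
Local Notation m := (half_color n).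

(* The tensor power of A = k[x]/(x^n) indexed by the circles of Gamma_alpha is
   free on the monomials, i.e. on the functions giving the exponent of x in each
   factor.  The element (alpha, f) of [gen] is the monomial f of A_alpha. *)
Definition monomial (alpha : state G) : finType :=
  {ffun circle Gamma alpha -> 'I_n}.

Definition gen : finType := {alpha : state G & monomial alpha}.

Definition gdeg (x : gen) : int :=
  \sum_(c : circle Gamma (tag x)) (m%:Z - (tagged x c)%:Z)
  + (m * weight (tag x))%:Z.

(* The direct sum of all the A_alpha. *)
Definition chain : lmodType k := {ffun gen -> k^o}.

Definition supported (P : pred gen) : chain -> bool :=
  fun w => [forall x, ~~ P x ==> (w x == 0)].
Fact supported_closed P : subsemimod_closed (supported P).
Proof.
split; first split.
- by apply/forallP=> x; rewrite ffunE eqxx implybT.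
- move=> u v /forallP Pu /forallP Pv; apply/forallP=> x; apply/implyP=> Px.
  by rewrite ffunE (eqP (implyP (Pu x) Px)) (eqP (implyP (Pv x) Px)) addr0.
- move=> a u /forallP Pu; apply/forallP=> x; apply/implyP=> Px.
  by rewrite ffunE (eqP (implyP (Pu x) Px)) scaler0.
Qed.
HB.instance Definition _ P :=
  GRing.isSubmodClosed.Build k chain (supported P) (supported_closed P).

(* Structure constants of mu, Delta and eta: the coefficients of x^l in
   mu(x^i (x) x^j), of x^i (x) x^j in Delta(x^l) and of x^j in eta(x^i).  They
   depend only on the total exponents a and b of their source and target. *)
Definition mu_coef (a b : nat) : k := (b == a)%:R.
Definition Delta_coef (a b : nat) : k := (b == a + m.*2)%:R.
Definition eta_coef (a b : nat) : k := sqrtn *+ (b == a + m).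

Definition touches (h : half_edge G) (c : {set side G}) : bool :=
  [exists b, ((inl h, b) \in c) || ((inl (opp h), b) \in c)].

Definition affected (h : half_edge G) (alpha : state G) : {set circle Gamma alpha} :=
  [set c | touches h (val c)].

Definition raise (alpha : state G) (h : half_edge G) : state G :=
  [ffun h' => (h' == h) || alpha h'].

(* A half-twist at h leaves unchanged the circles which do not run along the band
   of h; as sets of sides they are the same in both states. *)
Definition same_off (h : half_edge G) (x y : gen) : bool :=
  [forall c : circle Gamma (tag x), forall c' : circle Gamma (tag y),
     (val c == val c') && ~~ touches h (val c) ==>
     (tagged x c == tagged y c')].

Definition edge_coef (h : half_edge G) (x y : gen) : k :=
  let a := (\sum_(c in affected h (tag x)) tagged x c)%N in
  let b := (\sum_(c in affected h (tag y)) tagged y c)%N in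
  if [&& ~~ tag x h, tag y == raise (tag x) h & same_off h x y] then
    match #|affected h (tag x)|, #|affected h (tag y)| with
    | 2, 1 => mu_coef a b
    | 1, 2 => Delta_coef a b
    | 1, 1 => eta_coef a b
    | _, _ => 0
    end
  else 0.

(* The sum of the maps \partial_{alpha alpha'} where alpha' is obtained from
   alpha by changing the coordinate h from 0 to 1. *)
Definition edge_map (h : half_edge G) (w : chain) : chain :=
  [ffun y => \sum_x edge_coef h x y * (w x : k)].

Definition compose_path (hs : seq (half_edge G)) (w : chain) : chain :=
  foldl (fun u h => edge_map h u) w hs.

(* The projection onto A_alpha. *)
Definition proj_state (alpha : state G) (w : chain) : chain :=
  [ffun x => if tag x == alpha then w x else 0].

(* [ord] orders the vertices, and [hs v] lists the half-edges at v in the order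
   in which they are changed along the path chosen to define the maps
   \delta_{nu nu'}. *)
Section Differential.
Variables (ord : vertex G -> 'I_#|vertex G|) (hs : vertex G -> seq (half_edge G)).

Definition before (nu : {ffun vertex G -> bool}) (v : vertex G) : nat :=
  \sum_(u | (ord u < ord v)%N) nu u.

Definition delta (w : chain) : chain :=
  \sum_(nu : {ffun vertex G -> bool}) \sum_(v | ~~ nu v)
    (-1) ^+ before nu v *: compose_path (hs v) (proj_state (vstate nu) w).

Fact edge_map_is_linear h : linear (edge_map h).
Proof.
move=> a u v; apply/ffunP=> y; rewrite !ffunE scaler_sumr -big_split /=.
by apply: eq_bigr => x _; rewrite !ffunE mulrDr mulrCA.
Qed.
Fact compose_path_is_linear s : linear (compose_path s).
Proof.
elim: s => [|h s IHs] a u v //=.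
by rewrite /compose_path /= edge_map_is_linear; exact: IHs.
Qed.
Fact proj_state_is_linear alpha : linear (proj_state alpha).
Proof.
move=> a u v; apply/ffunP=> y; rewrite !ffunE.
by case: ifP => // _; rewrite scaler0 addr0.
Qed.
Fact delta_is_linear : linear delta.
Proof.
move=> a u v; rewrite /delta scaler_sumr -big_split; apply: eq_bigr => nu _ /=.
rewrite scaler_sumr -big_split; apply: eq_bigr => x _ /=.
by rewrite proj_state_is_linear compose_path_is_linear scalerDr !scalerA mulrC.
Qed.
HB.instance Definition _ :=
  GRing.isLinear.Build k chain chain *:%R delta delta_is_linear.

(* The monomials in the degree j part of the A_{alpha(nu)} with |nu| = i. *)
Definition bidegree (i j : int) : pred gen := fun x =>
  [exists nu : {ffun vertex G -> bool},
     (tag x == vstate nu) && ((weight nu)%:Z == i)] && (gdeg x == j).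

(* The chain module C^{i,j}. *)
Definition homogeneous (i j : int) : submodClosed chain :=
  GRing.SubmodClosed.clone k chain (supported (bidegree i j)) _.

Definition VCH (i j : int) : lmodType k :=
  homology delta (homogeneous (i - 1) j) (homogeneous i j).
End Differential.
End VertexHomology.

(* The admissible orderings of the vertices, and choices of paths. *)
Definition vertex_order (G : multigraph) (ord : vertex G -> 'I_#|vertex G|) :=
  injective ord.

Definition path_choice (G : multigraph) (hs : vertex G -> seq (half_edge G)) :=
  forall v, perm_eq (hs v) (enum (star v)).

Definition lmod_iso (k : pzRingType) (M N : lmodType k) : Prop :=
  exists f : {linear M -> N}, bijective f.

(** * Dimensions of modules *)

Section Dimension.
Variable k : comNzRingType.

Definition has_independent (M : lmodType k) (r : nat) : Prop :=
  exists e : 'I_r -> M, forall a : 'I_r -> k,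
    \sum_i a i *: e i = 0 -> forall i, a i = 0.

(* The largest number of linearly independent elements of M (0 if there is no
   bound); it is the usual rank if k is a domain, and the dimension if k is a
   field. *)
Definition rank (M : lmodType k) : nat :=
  xget 0%N [set r | has_independent M r /\
                    forall r', has_independent M r' -> (r' <= r)%N].

Definition sub_fin_gen (M : lmodType k) : Prop :=
  exists (N : lmodType k) (f : {linear M -> N}) (d : nat)
         (g : {linear 'rV[k]_d -> N}),
    injective f /\ (forall y, exists x, g x = y).

(* Over an arbitrary ring a homology module need not be free and there is no
   canonical notion of its dimension.  A dimension function is any function which
   is normalized and additive on short exact sequences (of submodules of finitely
   generated modules), for instance M |-> length M / length k if k is artinian. *)
Definition dimension_function (dim : lmodType k -> rat) : Prop :=
  dim k^o = 1 /\
  forall (M' M M'' : lmodType k) (f : {linear M' -> M}) (g : {linear M -> M''}),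
    sub_fin_gen M ->
    injective f -> (forall x, g x = 0 <-> exists y, f y = x) ->
    (forall z, exists x, g x = z) ->
    dim M = dim M' + dim M''.

Definition is_domain : Prop := forall x y : k, x * y = 0 -> x = 0 \/ y = 0.
End Dimension.

(** * Graded Euler characteristic and vertex polynomial *)

(* Laurent polynomials in q are regarded as rational functions. *)
Definition laurent : fieldType := {fraction {poly rat}}.
Definition var_q : laurent := tofrac ('X : {poly rat}).

Definition qdim (k : comNzRingType) (dim : lmodType k -> rat)
    (W : int -> lmodType k) : laurent :=
  \sum_(j \in [set: int]) var_q ^ j * tofrac ((dim (W j))%:P : {poly rat}).

Definition euler_char (k : comNzRingType) (dim : lmodType k -> rat)
    (W : int -> int -> lmodType k) : laurent :=
  \sum_(i \in [set: int]) (-1) ^ i * qdim dim (W i).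

Definition quantum_n (n : nat) : laurent :=
  \sum_(e < n) var_q ^ ((half_color n)%:Z - e%:Z).

Definition vertex_poly (G : multigraph) (Gamma : ribbon G) (n : nat) : laurent :=
  \sum_(nu : {ffun vertex G -> bool})
    (-1) ^+ weight nu * var_q ^+ (3 * half_color n * weight nu)
    * quantum_n n ^+ #|circles Gamma (vstate nu)|.

(* Main.v *)
Require Import Defs.
From HB Require Import structures.
From mathcomp Require Import all_boot all_order all_algebra.
From mathcomp Require Import perm zify ring.
From mathcomp Require Import boolp fsbigop.
From mathcomp Require classical_sets.
(* Imported again because mathcomp's [opp] would otherwise hide that of multigraphs. *)
Require Import Defs.

(* The complex.  Half-twists at different half-edges commute: A_alpha is cyclic over
   the polynomial ring on the sides of the edges, the maps mu, Delta and eta are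
   linear over it, and the image of a monomial is multiplied by 1,
   sum_(i + j = 2m) x_l^i x_r^j or sqrt n x_l^m, where l and r are the two sides of
   the twisted half-edge.  So two composites can only differ when the types of the
   two steps depend on their order; a finite check on how four sides can be
   distributed over circles leaves two cases, in which the products agree in
   A_alpha'' because sqrt n ^ 2 = n, x^n = 0 and (x_l - x_r) times the sum is 0.

   Invariance.  An equivalence of ribbon graphs induces a bijection of the sides,
   hence of the circles of all states, and commutation makes the choice of paths
   irrelevant.  Two orders of the vertices give complexes which are isomorphic by
   the sign (-1)^(number of inversions among the vertices of nu).

   Euler characteristic.  It is that of the chain modules by additivity of the
   dimension, and the monomials of A_alpha have generating function
   q^(m |alpha|) L_n(q)^k.  Over a domain the rank is a dimension function, since
   r + 1 vectors in k^r satisfy a nontrivial relation. *)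

Set Implicit Arguments.
Unset Strict Implicit.
Unset Printing Implicit Defensive.

Import Order.TTheory GRing.Theory Num.Theory.
Local Open Scope ring_scope.
Local Open Scope quotient_scope.

(** * Circles of a state and half-twists *)

(** Circles of different states live in different types, so tensor factors cannot be compared
    directly. Exponents are therefore attached to sides: one family of exponents names a monomial in
    every A_alpha, an edge map becomes an addition of exponents, and two composites are compared by
    their factors in the last state.

    The constants are matched to this. On a single circle the factor of Delta becomes 2m+1 equal
    terms x^(2m). For odd n this is n x^(n-1), the square of the factor sqrt n x^m of eta; for even
    n both are 0, since 2m = n.

    That only mu, Delta and eta occur is a parity fact: a half-twist cannot turn two circles into
    two. The same fact is one of the constraints of the finite check, and without it the check would
    have to admit patterns on which no map is defined. *)

Lemma even_fixfree_involution (T : finType) (f : T -> T) (A : {set T}) :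
  involutive f -> (forall x, x \in A -> f x \in A) ->
  (forall x, x \in A -> f x != x) -> ~~ odd #|A|.
Proof.
move=> fK fA fne; pose r (x : T) : nat := enum_rank x.
(* One element of each pair {x, f x}: the one of smaller rank. *)
pose B := [set x in A | (r x < r (f x))%N].
have fi : injective f := inv_inj fK.
have AB : A = B :|: f @: B.
  apply/setP=> x; rewrite !inE; apply/idP/idP.
    move=> Ax; rewrite Ax /=; case: ltngtP (fne x Ax) => //= [lt|eq] ne.
      rewrite -[x]fK mem_imset // inE fA //= fK //.
    by case/negP: ne; apply/eqP/enum_rank_inj/val_inj/esym.
  case/orP=> [/andP[]//|/imsetP[y]]; rewrite inE => /andP[Ay _] ->; exact: fA.
have dis : [disjoint B & f @: B].
  rewrite -setI_eq0; apply/eqP/setP=> x; rewrite !inE; apply/negP.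
  case/andP=> /andP[Ax lt] /imsetP[y]; rewrite inE => /andP[Ay lt'] xE.
  by move: lt; rewrite xE fK ltnNge ltnW.
move: dis; rewrite -(leq_card_setU B (f @: B)).2 -AB => /eqP->.
by rewrite card_imset // addnn odd_double.
Qed.

Section Sides.
Variables (G : multigraph) (Gamma : ribbon G).
Implicit Types (alpha beta : state G) (h : half_edge G) (s t : side G).

Local Notation left h := ((inl h, true) : side G).
Local Notation right h := ((inl h, false) : side G).

Lemma cornerK : involutive (corner Gamma).
Proof. by case=> -[h|c] [] //=; rewrite ?permK ?permKV. Qed.

Lemma twisted_opp alpha h : twisted Gamma alpha (opp h) = twisted Gamma alpha h.
Proof. by rewrite /twisted neg_opp oppK -!addbA (addbC (alpha h)). Qed.

Lemma bandK alpha : involutive (band Gamma alpha).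
Proof.
case=> -[h|c] b /=; rewrite ?oppK ?twisted_opp -addbA addbb ?addbF //.
Qed.

Lemma arc_sym alpha : symmetric (arc Gamma alpha).
Proof.
move=> s t; rewrite /arc; congr (_ || _).
  by apply/eqP/eqP=> ->; rewrite cornerK.
by apply/eqP/eqP=> ->; rewrite bandK.
Qed.

Definition same_circle alpha : rel (side G) := connect (arc Gamma alpha).

Lemma same_circle_sym alpha : symmetric (same_circle alpha).
Proof. exact/sym_connect_sym/arc_sym. Qed.

Lemma same_circle_refl alpha : reflexive (same_circle alpha).
Proof. exact: connect0. Qed.

Lemma same_circle_trans alpha : transitive (same_circle alpha).
Proof. exact: connect_trans. Qed.

Lemma same_circle_left alpha s t :
  same_circle alpha s t -> same_circle alpha s =1 same_circle alpha t.
Proof. exact: (same_connect (same_circle_sym alpha)). Qed.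

Lemma same_circle_right alpha s t :
  same_circle alpha s t -> same_circle alpha ^~ s =1 same_circle alpha ^~ t.
Proof. exact: (same_connect_r (same_circle_sym alpha)). Qed.

Lemma same_circle_band alpha s : same_circle alpha s (band Gamma alpha s).
Proof. by apply: connect1; rewrite /arc eqxx orbT. Qed.

Definition joined alpha h := same_circle alpha (left h) (right h).

(** This covers both ends of the band: each side at [opp h] is joined to a side at [h] by an arc
    along the band. *)
Definition touched alpha h s :=
  same_circle alpha (left h) s || same_circle alpha (right h) s.

Definition on_edge h s := (s.1 == inl h) || (s.1 == inl (opp h)).

Lemma touched_same alpha h s t :
  same_circle alpha s t -> touched alpha h s = touched alpha h t.
Proof. by move=> st; rewrite /touched !(same_circle_right st). Qed.

Lemma on_edge_touched alpha h s : on_edge h s -> touched alpha h s.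
Proof.
have half b : touched alpha h (inl h, b).
  by case: b; rewrite /touched same_circle_refl ?orbT.
case: s => -[h'|//] b /orP[] /eqP[->] //.
by rewrite (touched_same h (same_circle_band _ _)) /= oppK.
Qed.

(** Symmetric in alpha and beta, unlike [raise], so that facts about a half-twist can be used in
    both directions. *)
Definition toggled h alpha beta :=
  forall h', twisted Gamma beta h' =
             twisted Gamma alpha h' (+) ((h' == h) || (h' == opp h)).

Lemma toggled_sym h alpha beta : toggled h alpha beta -> toggled h beta alpha.
Proof. by move=> tog h'; rewrite tog -addbA addbb addbF. Qed.

Lemma raise_toggled h alpha : ~~ alpha h -> toggled h alpha (raise alpha h).
Proof.
move=> /negbTE a0 h'; rewrite /twisted !ffunE.
have -> : (opp h' == h) = (h' == opp h) by rewrite -(inj_eq (inv_inj (@oppK G))) oppK.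
case: eqVneq => [->|_] /=.
  by rewrite a0 (negbTE (_ : h != opp h)) 1?eq_sym ?opp_neq //=; case: neg; case: (alpha _).
case: eqVneq => [->|_] /=; last by rewrite addbF.
by rewrite oppK a0; case: neg; case: (alpha _).
Qed.

Lemma band_toggled h alpha beta s : toggled h alpha beta ->
  ~~ on_edge h s -> band Gamma beta s = band Gamma alpha s.
Proof.
case: s => -[h'|c] b tog //=; rewrite /on_edge /= => /negbTE off.
by rewrite tog [_ || _]off addbF.
Qed.

Lemma untouched_arc h alpha beta s : toggled h alpha beta ->
  ~~ touched alpha h s -> arc Gamma alpha s =1 arc Gamma beta s.
Proof.
move=> tog un t; rewrite /arc (band_toggled tog) //.
by apply: contra un; apply: on_edge_touched.
Qed.

(** Only arcs along the band of [h] change. Being untouched depends on the circle alone, so it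
    propagates along a path, which is then a path in both states. *)
Lemma untouched_same h alpha beta s : toggled h alpha beta ->
  ~~ touched alpha h s -> same_circle alpha s =1 same_circle beta s.
Proof.
move=> tog un t; apply/idP/idP=> /connectP[p] +->{t}.
  elim: p s un => [|t p IHp] s un /=; first by move=> _; apply: connect0.
  move=> /andP[st tp].
  have un' : ~~ touched alpha h t by rewrite -(touched_same h (connect1 st)).
  apply: connect_trans (IHp t un' tp); apply: connect1.
  by rewrite -(untouched_arc tog un).
elim: p s un => [|t p IHp] s un /=; first by move=> _; apply: connect0.
rewrite -(untouched_arc tog un) => /andP[st tp].
have un' : ~~ touched alpha h t by rewrite -(touched_same h (connect1 st)).
by apply: connect_trans (IHp t un' tp); apply: connect1.
Qed.

Lemma touched_toggled h alpha beta : toggled h alpha beta ->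
  touched alpha h =1 touched beta h.
Proof.
have imp a b s : toggled h a b -> touched b h s -> touched a h s.
  move=> tog tb; apply: contraLR tb => un; move: (un).
  by rewrite /touched !(same_circle_sym _ _ s) !(untouched_same tog un).
by move=> tog s; apply/idP/idP; apply: imp => //; apply: toggled_sym.
Qed.

(* Outside the band of h the boundary consists of arcs and circles; the arcs pair
   up the four sides of the edge of h. *)
Lemma joined_toggled h alpha beta : toggled h alpha beta ->
  joined alpha h || joined beta h.
Proof.
move=> tog.
(* The arcs common to both states: all except those along the band of [h]. *)
pose O : rel (side G) := fun s t =>
  (t == corner Gamma s) || ((t == band Gamma alpha s) && ~~ on_edge h s).
have Oconn gamma : gamma = alpha \/ gamma = beta ->
    subrel (connect O) (same_circle gamma).
  move=> gE; apply: connect_sub => s t /orP[/eqP->|/andP[/eqP-> off]].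
    by apply: connect1; rewrite /arc eqxx.
  by case: gE => ->; [|rewrite -(band_toggled tog off)]; exact: same_circle_band.
(* Sides of vertex-less edges are left out because [corner] fixes them. *)
pose A := [set s | connect O (left h) s & if s.1 is inl _ then true else false].
have Acorner s : s \in A -> corner Gamma s \in A.
  rewrite !inE => /andP[cs il]; apply/andP; split; last by case: s il {cs} => -[] ? [].
  by apply: connect_trans cs _; apply: connect1; rewrite /O eqxx.
have evenA : ~~ odd #|A|.
  apply: even_fixfree_involution cornerK Acorner _ => -[[h'|c] b]; rewrite inE andbC //= => _.
  by case: b; apply/eqP=> -[].
(* [corner] has no fixed point on [A], nor [band] on [A] without the edge of [h]. Hence [B] has an
   even number of elements, and one besides the left side of [h]. *)
pose B := A :&: [set s | on_edge h s].
have evenD : ~~ odd #|A :\: [set s | on_edge h s]|.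
  apply: (even_fixfree_involution (bandK alpha)) => s; rewrite !inE => /and3P[off cs il].
    apply/and3P; split; last by case: s il {cs off} => -[].
      apply: contra off; case: s il {cs} => -[h'|//] b _ /=.
      by rewrite /on_edge !(inj_eq inl_inj) /= (inj_eq (inv_inj (@oppK G)))
        -{1}[h]oppK (inj_eq (inv_inj (@oppK G))) orbC.
    by apply: connect_trans cs _; apply: connect1; rewrite /O eqxx off orbT.
  case: s il {off cs} => -[h'|//] b _ /=; apply/eqP=> -[e _].
  by have := opp_neq h'; rewrite e eqxx.
have evenB : ~~ odd #|B|.
  by move: evenA; rewrite -(cardsID [set s | on_edge h s] A) oddD (negbTE evenD) addbF.
have lB : left h \in B by rewrite !inE connect0 /= /on_edge eqxx.
have [s sB sl] : exists2 s, s \in B & s != left h.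
  apply/exists_inP; apply: contraR evenB => /exists_inPn nB.
  suff -> : B = [set left h] by rewrite cards1.
  apply/setP=> s; rewrite in_set1; apply/idP/eqP=> [/nB|->//].
  by rewrite negbK => /eqP.
move: sB; rewrite !inE => /andP[/andP[cs _] on].
have ca : same_circle alpha (left h) s by apply: (Oconn alpha) => //; left.
have cb : same_circle beta (left h) s by apply: (Oconn beta) => //; right.
case: s on sl ca cb {cs} => -[h'|//] b /orP[] /eqP[->].
  by case: b => [/eqP//|_ ca cb]; rewrite /joined ca.
move=> _ ca cb.
(* From a side at [opp h] the band leads to different sides of [h] in the two states, so in one of
   them to the right side. *)
move: (connect_trans ca (same_circle_band alpha _)) (connect_trans cb (same_circle_band beta _)).
rewrite /= oppK tog eqxx orbT addbT negbK /joined.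
by case: b {ca cb}; case: twisted => /= ca cb; apply/orP;
  first [by left | by right].
Qed.


(* 0, 1 or 2 according as the half-twist at h acts by mu, eta or Delta. *)
Definition step_type alpha beta h : nat := joined alpha h + ~~ joined beta h.

End Sides.

(** * The finite check on four sides *)

Definition allb (P : bool -> bool) : bool := if P true then P false else false.

Lemma allbP (P : bool -> bool) : allb P -> forall b, P b.
Proof. by rewrite /allb; case: ifP => // Pt Pf []. Qed.

(* [pij] says that i and j are on the same circle, where 1, 2, 3, 4 stand for the
   left and right sides of h1 and the left and right sides of h2. *)
Record four_points := FourPoints { p12 : bool; p13 : bool; p14 : bool;
                                   p23 : bool; p24 : bool; p34 : bool }.

Definition all4p (P : four_points -> bool) : bool :=
  allb (fun a => allb (fun b => allb (fun c => allb (fun d => allb (fun e =>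
  allb (fun f => P (FourPoints a b c d e f))))))).

Lemma all4pP P : all4p P -> forall r, P r.
Proof.
move=> /allbP H [a b c d e f].
by move: (H a) => /allbP/(_ b)/allbP/(_ c)/allbP/(_ d)/allbP/(_ e)/allbP/(_ f).
Qed.

(** Transitivity on each of the four triples; reflexivity and symmetry are built into the
    encoding. *)
Definition fp_trans (r : four_points) : bool :=
  let: FourPoints a b c d e f := r in
  [&& a && b ==> d, a && d ==> b, b && d ==> a,
      a && c ==> e, a && e ==> c, c && e ==> a,
      b && c ==> f, b && f ==> c, c && f ==> b,
      d && e ==> f, d && f ==> e & e && f ==> d].

(* What a half-twist at h1 can change: it rearranges the circles through 1 and 2
   among themselves, and does not separate 1 from 2 both before and after. *)
Definition fp_step1 (r r' : four_points) : bool :=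
  [&& p13 r || p23 r == p13 r' || p23 r', p14 r || p24 r == p14 r' || p24 r',
      ~~ (p13 r || p23 r) || ~~ (p14 r || p24 r) ==> (p34 r == p34 r')
    & p12 r || p12 r'].

Definition fp_step2 (r r' : four_points) : bool :=
  [&& p13 r || p14 r == p13 r' || p14 r', p23 r || p24 r == p23 r' || p24 r',
      ~~ (p13 r || p14 r) || ~~ (p23 r || p24 r) ==> (p12 r == p12 r')
    & p34 r || p34 r'].

Definition fp_type1 (r r' : four_points) : nat := p12 r + ~~ p12 r'.
Definition fp_type2 (r r' : four_points) : nat := p34 r + ~~ p34 r'.

(* If the types of the steps depend on their order, then in the end either all four
   sides are on one circle, or h1 and h2 both have their sides on the same two
   circles and come last of type Delta. *)
Definition fp_square (r r1 r2 r12 : four_points) : bool :=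
  let t1 := fp_type1 r r1 in let t2' := fp_type2 r1 r12 in
  let t2 := fp_type2 r r2 in let t1' := fp_type1 r2 r12 in
  [|| (t1 == t1') && (t2 == t2'),
      [&& p12 r12, p34 r12, p13 r12 & (t1 + t2' == t2 + t1')%N]
    | [&& t1 == t2, (t1 < 2)%N, t1' == 2, t2' == 2
        & p13 r12 && p24 r12 || p14 r12 && p23 r12]].

Lemma fp_squareP r r1 r2 r12 :
  fp_trans r -> fp_trans r1 -> fp_trans r2 -> fp_trans r12 ->
  fp_step1 r r1 -> fp_step2 r1 r12 -> fp_step2 r r2 -> fp_step1 r2 r12 ->
  fp_square r r1 r2 r12.
Proof.
(* Nested [if]s prune the 2^24 quadruples: [vm_compute] would evaluate both arguments of an
   [==>]. *)
have /all4pP H : all4p (fun r => if fp_trans r then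
  all4p (fun r1 => if fp_trans r1 && fp_step1 r r1 then
  all4p (fun r2 => if fp_trans r2 && fp_step2 r r2 then
  all4p (fun r12 => if [&& fp_trans r12, fp_step2 r1 r12 & fp_step1 r2 r12]
    then fp_square r r1 r2 r12 else true) else true) else true) else true).
  by vm_compute.
move=> tr tr1 tr2 tr12 s1 s2' s2 s1'.
move: (H r); rewrite tr => /all4pP/(_ r1); rewrite tr1 s1 => /all4pP/(_ r2).
by rewrite tr2 s2 => /all4pP/(_ r12); rewrite tr12 s2' s1'.
Qed.

Section TwoEdges.
Variables (G : multigraph) (Gamma : ribbon G).
Variables (h1 h2 : half_edge G).
Local Notation left h := ((inl h, true) : side G).
Local Notation right h := ((inl h, false) : side G).

Definition fp_of (alpha : state G) : four_points :=
  let e := same_circle Gamma alpha in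
  FourPoints (e (left h1) (right h1)) (e (left h1) (left h2))
    (e (left h1) (right h2)) (e (right h1) (left h2)) (e (right h1) (right h2))
    (e (left h2) (right h2)).

Lemma fp_of_trans alpha : fp_trans (fp_of alpha).
Proof.
have tr a b c : same_circle Gamma alpha a b && same_circle Gamma alpha b c ==>
    same_circle Gamma alpha a c.
  by apply/implyP=> /andP[]; apply: same_circle_trans.
have sy := same_circle_sym Gamma alpha.
rewrite /fp_trans /fp_of; apply/and5P; split;
  last (apply/and5P; split; last (apply/and4P; split)).
- by rewrite (sy (left h1) (right h1)) tr.
- by rewrite tr.
- by rewrite (sy (right h1) (left h2)) tr.
- by rewrite (sy (left h1) (right h1)) tr.
- by rewrite tr.
- by rewrite (sy (right h1) (right h2)) tr.
- by rewrite (sy (left h1) (left h2)) tr.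
- by rewrite tr.
- by rewrite (sy (left h2) (right h2)) tr.
- by rewrite (sy (right h1) (left h2)) tr.
- by rewrite tr.
- by rewrite (sy (left h2) (right h2)) tr.
Qed.

Lemma fp_of_step1 alpha beta :
  toggled Gamma h1 alpha beta -> fp_step1 (fp_of alpha) (fp_of beta).
Proof.
move=> tog; have tE := touched_toggled tog; rewrite /fp_step1 /fp_of /=.
apply/and4P; split.
- by apply/eqP; exact: (tE (left h2)).
- by apply/eqP; exact: (tE (right h2)).
- apply/implyP=> /orP[] un.
    by rewrite (untouched_same tog un).
  by rewrite !(same_circle_sym _ _ (left h2)) (untouched_same tog un).
- exact: joined_toggled tog.
Qed.
End TwoEdges.

Section TwoEdgesSym.
Variables (G : multigraph) (Gamma : ribbon G) (h1 h2 : half_edge G).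

Lemma fp_of_step2 alpha beta :
  toggled Gamma h2 alpha beta -> fp_step2 (fp_of Gamma h1 h2 alpha) (fp_of Gamma h1 h2 beta).
Proof.
move/(fp_of_step1 h1); rewrite /fp_step1 /fp_step2 /fp_of /=.
have sy b b' gamma : same_circle Gamma gamma (inl h2, b) (inl h1, b') =
  same_circle Gamma gamma (inl h1, b') (inl h2, b) by apply: same_circle_sym.
by rewrite 2!(sy true true) 2!(sy true false) 2!(sy false true) 2!(sy false false).
Qed.
End TwoEdgesSym.

(** * Monomials and edge maps *)

Section Generators.
Variables (G : multigraph) (Gamma : ribbon G).
Implicit Types (alpha beta : state G) (h : half_edge G) (s t : side G).

Lemma circle_of_proof alpha s :
  [set t | connect (arc Gamma alpha) s t] \in circles Gamma alpha.
Proof. by apply/imsetP; exists s. Qed.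

Definition circle_of alpha s : circle Gamma alpha :=
  exist _ [set t | connect (arc Gamma alpha) s t] (circle_of_proof alpha s).

Lemma in_circle_of alpha s t :
  (t \in val (circle_of alpha s)) = same_circle Gamma alpha s t.
Proof. by rewrite inE. Qed.

Lemma circle_of_eq alpha s t :
  (circle_of alpha s == circle_of alpha t) = same_circle Gamma alpha s t.
Proof.
apply/eqP/idP=> [e|st].
  by rewrite -in_circle_of e in_circle_of same_circle_refl.
by apply: val_inj; apply/setP=> u; rewrite !in_circle_of (same_circle_left st).
Qed.

Lemma circle_rep_proof alpha (c : circle Gamma alpha) : exists s, s \in val c.
Proof.
case: c => c /= /imsetP[s _ ->]; exists s; rewrite inE; exact: connect0.
Qed.

Definition circle_rep alpha (c : circle Gamma alpha) : side G :=
  xchoose (circle_rep_proof c).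

Lemma circle_repK alpha : cancel (@circle_rep alpha) (circle_of alpha).
Proof.
move=> c; have := xchooseP (circle_rep_proof c); rewrite -/(circle_rep c).
case/imsetP: (valP c) => s _ cE; move: (circle_rep _) => t.
rewrite cE inE => st; apply: val_inj; apply/setP=> u.
by rewrite cE in_circle_of inE -(same_circle_left st).
Qed.

Lemma circle_ofP alpha (c : circle Gamma alpha) : exists s, c = circle_of alpha s.
Proof. by exists (circle_rep c); rewrite circle_repK. Qed.

Lemma same_circle_rep alpha s :
  same_circle Gamma alpha (circle_rep (circle_of alpha s)) s.
Proof. by rewrite -circle_of_eq circle_repK. Qed.

Variable n : nat.
Hypothesis n_gt0 : (0 < n)%N.

(** Indexing by sides lets generators of different states be compared without a bijection between
    their circles. *)
Definition exponent (x : gen Gamma n) s : nat := tagged x (circle_of (tag x) s).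

Lemma exponent_lt x s : (exponent x s < n)%N.
Proof. exact: ltn_ord. Qed.

Lemma exponent_same x s t :
  same_circle Gamma (tag x) s t -> exponent x s = exponent x t.
Proof. by rewrite -circle_of_eq /exponent => /eqP->. Qed.

Lemma gen_eq x y : tag x = tag y -> exponent x =1 exponent y -> x = y.
Proof.
case: x y => a f [b g] /= ab; case: _ / ab g => g e; congr existT.
apply/ffunP=> c; have [s ->] := circle_ofP c; apply: val_inj; exact: (e s).
Qed.

(** Meant for [e] constant on circles and below n: then neither the choice of [circle_rep] nor the
    default 0 of [insubd] matters. *)
Definition gen_of alpha (e : side G -> nat) : gen Gamma n :=
  Tagged (monomial Gamma n)
    ([ffun c => insubd (Ordinal n_gt0) (e (circle_rep c))] : monomial Gamma n alpha).

Lemma exponent_gen_of alpha e :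
  (forall s t, same_circle Gamma alpha s t -> e s = e t) ->
  (forall s, (e s < n)%N) -> exponent (gen_of alpha e) =1 e.
Proof.
move=> ec en s; rewrite /exponent /= ffunE insubdK ?[_ \in _]en //.
exact/ec/same_circle_rep.
Qed.

Lemma touchesE h alpha s :
  touches h (val (circle_of alpha s)) = touched Gamma alpha h s.
Proof.
rewrite /touches /touched !(same_circle_sym _ _ _ s).
apply/existsP/orP=> [[b]|[] c].
- have half b' : same_circle Gamma alpha s (inl h, b') ->
    same_circle Gamma alpha s (inl h, true) \/ same_circle Gamma alpha s (inl h, false).
    by case: b' => ?; [left|right].
  case/orP; rewrite in_circle_of; first exact: half.
  move=> c; have := same_circle_trans c (same_circle_band _ _ _).
  by rewrite /= oppK; apply: half.
- by exists true; rewrite in_circle_of c.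
- by exists false; rewrite in_circle_of c.
Qed.

Lemma affectedE h alpha : affected Gamma h alpha =
  [set circle_of alpha (inl h, true); circle_of alpha (inl h, false)].
Proof.
apply/setP=> c; have [s ->] := circle_ofP c.
by rewrite !inE touchesE !circle_of_eq /touched !(same_circle_sym _ _ s).
Qed.

Lemma card_affected h alpha :
  #|affected Gamma h alpha| = (~~ joined Gamma alpha h).+1.
Proof. by rewrite affectedE cards2 circle_of_eq. Qed.

Definition total h (x : gen Gamma n) : nat :=
  (exponent x (inl h, true) +
   if joined Gamma (tag x) h then 0 else exponent x (inl h, false))%N.

Lemma sum_affected h (x : gen Gamma n) :
  (\sum_(c in affected Gamma h (tag x)) tagged x c)%N = total h x.
Proof.
rewrite affectedE /total; case: ifP => j; last first.
  by rewrite big_setU1 ?inE ?circle_of_eq ?[same_circle _ _ _ _]j //= big_set1.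
have e : circle_of (tag x) (inl h, true) = circle_of (tag x) (inl h, false).
  by apply/eqP; rewrite circle_of_eq.
by rewrite /exponent e setUid big_set1 addn0.
Qed.

Lemma same_offP h (x y : gen Gamma n) : toggled Gamma h (tag x) (tag y) ->
  reflect (forall s, ~~ touched Gamma (tag x) h s -> exponent x s = exponent y s)
    (same_off h x y).
Proof.
move=> tog; apply: (iffP forallP) => [so s un|so c].
  move: (so (circle_of (tag x) s)) => /forallP/(_ (circle_of (tag y) s)).
  rewrite touchesE un andbT => /implyP/(_ _)/eqP e; apply: congr1 (e _).
  by apply/eqP/setP=> t; rewrite !in_circle_of (untouched_same tog un).
apply/forallP=> c'; apply/implyP=> /andP[/eqP e].
have [s cE] := circle_ofP c; rewrite cE touchesE => un.
have -> : c' = circle_of (tag y) s.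
  apply: val_inj; rewrite -e cE; apply/setP=> t.
  by rewrite !in_circle_of (untouched_same tog un).
by apply/eqP/val_inj; apply: so.
Qed.

End Generators.

(** * Edge maps as multiplications by polynomials in the sides *)

Section EdgeMaps.
Variables (G : multigraph) (Gamma : ribbon G) (n : nat).
Variables (k : comNzRingType) (sqrtn : k).
Hypothesis n_gt0 : (0 < n)%N.
Hypothesis sqrtn2 : sqrtn ^+ 2 = n%:R.
Implicit Types (alpha beta : state G) (h : half_edge G) (s t : side G).

Local Notation m := (half_color n).
Local Notation left h := ((inl h, true) : side G).
Local Notation right h := ((inl h, false) : side G).

(** An equality for odd n, whereas 2m = n for even n. In both cases x^(2m+1) = 0. *)
Lemma half_color_lb : (n <= m.*2.+1)%N.
Proof. by rewrite /half_color -{1}[n]odd_double_half; case: odd; rewrite ?add0n. Qed.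

Lemma half_color_even : m.*2.+1 != n -> (n <= m.*2)%N.
Proof. by have := half_color_lb; rewrite leq_eqVlt eq_sym => /orP[->|]. Qed.

(** mu, eta and Delta raise the total exponent by 0, m and 2m, that is, by m times the step type.
    [joined_toggled] excludes two circles both before and after. *)
Lemma edge_coefE h (x y : gen Gamma n) : edge_coef sqrtn h x y =
  if [&& ~~ tag x h, tag y == raise (tag x) h & same_off h x y]
  then sqrtn ^+ (joined Gamma (tag x) h && joined Gamma (tag y) h) *
    (total h y == total h x + m * step_type Gamma (tag x) (tag y) h)%N%:R
  else 0.
Proof.
rewrite /edge_coef; case: ifP => // /and3P[x0 /eqP ty _].
rewrite !card_affected !sum_affected /step_type.
have := joined_toggled (raise_toggled Gamma x0); rewrite -ty.
case: (joined _ (tag x)); case: (joined _ (tag y)) => //= _.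
- by rewrite /eta_coef muln1 mulr_natr.
- by rewrite /Delta_coef mul1r muln2.
- by rewrite /mu_coef mul1r muln0 addn0.
Qed.

Notation exps := ({ffun side G -> nat}).

Definition unit_exp s : exps := [ffun t => (t == s) : nat].

Definition circle_sum alpha (u : exps) s : nat :=
  (\sum_(t | same_circle Gamma alpha s t) u t)%N.

Lemma circle_sumD alpha u v s :
  circle_sum alpha (u + v) s = (circle_sum alpha u s + circle_sum alpha v s)%N.
Proof. by rewrite /circle_sum -big_split; apply: eq_bigr => t _; rewrite ffunE. Qed.

Lemma circle_sum_unit alpha t i s :
  circle_sum alpha (unit_exp t *+ i) s = (same_circle Gamma alpha s t * i)%N.
Proof.
rewrite /circle_sum; under eq_bigr => r _ do rewrite ffunMnE ffunE.
have natM (a b : nat) : a *+ b = (b * a)%N.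
  by elim: b => // b IHb; rewrite mulrS IHb mulSn.
case: (boolP (same_circle _ _ _ _)) => c; last first.
  rewrite mul0n big1 // => r cr; rewrite natM (_ : r == t = false) ?muln0 //.
  by apply/eqP=> rt; rewrite -rt cr in c.
rewrite (bigD1 t) //= eqxx natM muln1 mul1n big1 ?addn0 // => r /andP[_ /negbTE->].
by rewrite natM muln0.
Qed.

Lemma circle_sum_same alpha u s t : same_circle Gamma alpha s t ->
  circle_sum alpha u s = circle_sum alpha u t.
Proof.
by move=> st; apply: eq_bigl => r; rewrite (same_circle_left st).
Qed.

(* The monomial prod_s x_s^(u s) of A_alpha, where x_s is the variable of the
   circle through the side s; it is 0 if an exponent exceeds n - 1. *)
Definition mono alpha (u : exps) : chain Gamma n k :=
  [ffun x : gen Gamma n =>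
    ((tag x == alpha) && [forall s, exponent x s == circle_sum alpha u s])%:R : k].

Lemma mono_eq alpha u v : circle_sum alpha u =1 circle_sum alpha v ->
  mono alpha u = mono alpha v.
Proof.
move=> e; apply/ffunP=> x; rewrite !ffunE; congr (_ && _)%:R.
by apply: eq_forallb => s; rewrite e.
Qed.

Lemma mono_eq0 alpha u s : (n <= circle_sum alpha u s)%N -> mono alpha u = 0.
Proof.
move=> ge; apply/ffunP=> x; rewrite !ffunE; case: andP => // -[_ /forallP/(_ s)/eqP e].
by have := exponent_lt x s; rewrite e ltnNge ge.
Qed.

Lemma mono_move alpha u s t i : same_circle Gamma alpha s t ->
  mono alpha (u + unit_exp s *+ i) = mono alpha (u + unit_exp t *+ i).
Proof.
move=> st; apply: mono_eq => r; rewrite !circle_sumD !circle_sum_unit.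
by rewrite (same_circle_right st).
Qed.

Lemma mono_gen_of alpha u (un : forall s, (circle_sum alpha u s < n)%N) x :
  mono alpha u x = (x == gen_of Gamma n_gt0 alpha (circle_sum alpha u))%:R.
Proof.
rewrite ffunE; congr (nat_of_bool _)%:R.
have ex := exponent_gen_of n_gt0 (circle_sum_same u) un.
apply/andP/eqP=> [[/eqP tx /forallP e]|->]; last first.
  by rewrite eqxx; split=> //; apply/forallP=> s; rewrite ex.
by apply: gen_eq => // s; rewrite ex; apply/eqP.
Qed.

(* mono alpha' u multiplied by the image of 1 under mu, eta or Delta (t = 0, 1, 2),
   with phi = mono alpha'.  For even n the sum has the extra terms i = 0 and i = n,
   which vanish since x^n = 0. *)
Definition twist_op h (t : nat) (phi : exps -> chain Gamma n k) (u : exps) :=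
  match t with
  | 0 => phi u
  | 1 => sqrtn *: phi (u + unit_exp (left h) *+ m)
  | _ => \sum_(i < m.*2.+1)
      phi (u + (unit_exp (left h) *+ i + unit_exp (right h) *+ (m.*2 - i)))
  end.


Definition touched_sum alpha h (u : exps) : nat :=
  (circle_sum alpha u (left h) +
   if joined Gamma alpha h then 0 else circle_sum alpha u (right h))%N.

(** In this form the sum is visibly the same before and after the half-twist, which does not change
    the set of touched sides. *)
Lemma touched_sumE alpha h u :
  touched_sum alpha h u = (\sum_(s | touched Gamma alpha h s) u s)%N.
Proof.
rewrite /touched_sum /touched; case: ifP => j.
  rewrite addn0; apply: eq_bigl => s.
  by rewrite -(same_circle_left j) orbb.
rewrite [RHS](bigID (same_circle Gamma alpha (left h))) /=; congr (_ + _)%N.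
  by apply: eq_bigl => s; rewrite orbK.
apply: eq_bigl => s; case: (boolP (same_circle _ _ (left h) s)) => [ls|_] /=.
  by apply/negP=> rs; move: j; rewrite /joined (same_circle_right rs) ls.
by rewrite andbT.
Qed.

Lemma touched_sum_toggled h alpha beta u : toggled Gamma h alpha beta ->
  touched_sum alpha h u = touched_sum beta h u.
Proof.
by move=> tog; rewrite !touched_sumE; apply: eq_bigl; apply: touched_toggled.
Qed.

Lemma circle_sum_untouched h alpha beta u s : toggled Gamma h alpha beta ->
  ~~ touched Gamma alpha h s -> circle_sum alpha u s = circle_sum beta u s.
Proof. by move=> tog un; apply: eq_bigl => t; rewrite (untouched_same tog un). Qed.

Lemma untouched_unit alpha h b i s : ~~ touched Gamma alpha h s ->
  circle_sum alpha (unit_exp (inl h, b) *+ i) s = 0%N.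
Proof.
rewrite circle_sum_unit same_circle_sym /touched negb_or => /andP[n1 n2].
by case: b; rewrite ?(negbTE n1) ?(negbTE n2).
Qed.

Lemma touched_circle_sum alpha h u s : touched Gamma alpha h s ->
  circle_sum alpha u s = circle_sum alpha u (left h) \/
  circle_sum alpha u s = circle_sum alpha u (right h).
Proof.
by case/orP; rewrite same_circle_sym => /circle_sum_same ->; [left|right].
Qed.

Lemma forall_split h alpha (P : side G -> bool) :
  (forall s t, same_circle Gamma alpha s t -> P s = P t) ->
  [forall s, P s] = [&& [forall s, ~~ touched Gamma alpha h s ==> P s],
                        P (left h) & P (right h)].
Proof.
move=> Ps; apply/forallP/and3P=> [a|[/forallP un l r] s].
  by split=> //; apply/forallP=> s; rewrite a implybT.
move: (un s); case: (boolP (touched _ _ _ _)) => //=.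
by case/orP=> /Ps <-.
Qed.

Lemma exponent_circle_sum alpha v (y : gen Gamma n) s t : tag y = alpha ->
  same_circle Gamma alpha s t ->
  (exponent y s == circle_sum alpha v s) = (exponent y t == circle_sum alpha v t).
Proof.
by move=> ty st; rewrite (circle_sum_same v st) (exponent_same (t := t)) ?ty.
Qed.

Lemma mono_split h alpha v (y : gen Gamma n) : tag y = alpha ->
  mono alpha v y = [&& [forall s, ~~ touched Gamma alpha h s ==>
      (exponent y s == circle_sum alpha v s)],
      exponent y (left h) == circle_sum alpha v (left h)
    & exponent y (right h) == circle_sum alpha v (right h)]%:R.
Proof.
move=> ty; rewrite ffunE ty eqxx /=; congr (nat_of_bool _)%:R.
apply: forall_split => s t; exact: exponent_circle_sum.
Qed.

Lemma mono_tag alpha v (y : gen Gamma n) : tag y != alpha -> mono alpha v y = 0.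
Proof. by rewrite ffunE => /negbTE->. Qed.

Lemma circle_sum_addl alpha u v s :
  (circle_sum alpha u s <= circle_sum alpha (u + v)%R s)%N.
Proof. by rewrite circle_sumD leq_addr. Qed.

(** Multiplication is well defined on A_alpha: a monomial killed by x^n = 0 before the half-twist
    has image 0. *)
Lemma twist_op_eq0 h alpha (u : exps) s : ~~ alpha h ->
  let beta := raise alpha h in
  (n <= circle_sum alpha u s)%N ->
  twist_op h (step_type Gamma alpha beta h) (mono beta) u = 0.
Proof.
move=> a0 beta ge; have tog : toggled Gamma h alpha beta := raise_toggled Gamma a0.
have := joined_toggled tog; have := touched_sum_toggled u tog.
rewrite /step_type; case: (boolP (touched Gamma alpha h s)) => [th|un] tsE.
  have {}ge : (n <= touched_sum alpha h u)%N.
    apply: leq_trans ge _; rewrite /touched_sum.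
    case: (boolP (joined _ alpha h)) => j; last first.
      by have [->|->] := touched_circle_sum u th; rewrite ?leq_addr ?leq_addl.
    rewrite addn0; have [->|->] // := touched_circle_sum u th.
    by rewrite (circle_sum_same u j).
  rewrite tsE /touched_sum in ge.
  case: (boolP (joined _ beta h)) ge => jb ge; last rewrite orbF => ->.
    rewrite addn0 in ge => _.
    have z v : mono beta (u + v) = 0.
      by apply: (mono_eq0 (s := left h)); apply: leq_trans ge (circle_sum_addl _ _ _ _).
    by case: joined => /=; rewrite ?z ?scaler0 // -[u]addr0 z.
  (* After a split the two exponents of each term add up to at least n + 2m >= 2n - 1, so one of
     them is at least n. *)
  rewrite /= big1 // => i _; have /negbTE njb := jb; rewrite /joined in njb.
  have := half_color_lb; have ilt := ltn_ord i.
  case: (leqP n (circle_sum beta u (left h) + i)) => [gel|ltl] lb.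
    apply: (mono_eq0 (s := left h)).
    by rewrite !circle_sumD !circle_sum_unit same_circle_refl njb; lia.
  apply: (mono_eq0 (s := right h)).
  rewrite !circle_sumD !circle_sum_unit same_circle_refl same_circle_sym njb; lia.
have z v : mono beta (u + v) = 0.
  apply: (mono_eq0 (s := s)); apply: leq_trans (circle_sum_addl _ _ _ _).
  by rewrite -(circle_sum_untouched u tog un).
move=> _; case: (nat_of_bool _ + _)%N => [|[|t]] /=; rewrite ?z ?scaler0 //.
  by rewrite -[u]addr0 z.
by rewrite big1 // => i _; rewrite z.
Qed.

(** Coefficients are compared at each generator [y]. Away from [h] both sides ask for unchanged
    exponents; at [h] the structure constants see only the total exponent, as does the product with
    the image of 1. *)
Lemma edge_map_mono h alpha (u : exps) : ~~ alpha h ->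
  edge_map sqrtn h (mono alpha u) =
  twist_op h (step_type Gamma alpha (raise alpha h) h) (mono (raise alpha h)) u.
Proof.
move=> a0; set beta := raise alpha h.
have tog : toggled Gamma h alpha beta := raise_toggled Gamma a0.
have [/existsP[s ge]|small] := boolP [exists s, n <= circle_sum alpha u s]%N.
  rewrite (mono_eq0 ge) (twist_op_eq0 a0 ge); apply/ffunP=> y.
  by rewrite !ffunE big1 // => x _; rewrite ffunE mulr0.
have {}small s : (circle_sum alpha u s < n)%N.
  by rewrite ltnNge; apply: contra small => ge; apply/existsP; exists s.
pose x := gen_of Gamma n_gt0 alpha (circle_sum alpha u).
have exE : exponent x =1 circle_sum alpha u.
  exact: (exponent_gen_of n_gt0 (circle_sum_same u) small).
apply/ffunP=> y; rewrite ffunE (bigD1 x) //= big1 ?addr0 => [|z zx]; last first.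
  by rewrite (mono_gen_of small) -/x (negbTE zx) mulr0.
rewrite (mono_gen_of small) -/x eqxx mulr1 edge_coefE /= a0 /=.
have [tyE|tyN] := eqVneq (tag y) beta; last first.
  rewrite /step_type /=; case: (nat_of_bool _ + _)%N => [|[|t]] /=; rewrite ?mono_tag //.
    by rewrite ffunE mono_tag ?scaler0.
  by rewrite sum_ffunE big1 // => i _; rewrite mono_tag.
rewrite tyE; set off := same_off h x y.
have offE : off = [forall s, ~~ touched Gamma beta h s ==>
    (exponent y s == circle_sum beta u s)].
  have togxy : toggled Gamma h (tag x) (tag y) by rewrite tyE.
  apply/(same_offP togxy)/forallP=> [so s|so s un].
    rewrite -(touched_toggled tog); apply/implyP=> un.
    by rewrite -(so s un) exE (circle_sum_untouched u tog un).
  rewrite exE (circle_sum_untouched u tog un); apply/esym/eqP.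
  by move: (so s); rewrite -(touched_toggled tog) un.
have offE' v : (forall s, ~~ touched Gamma beta h s -> circle_sum beta v s = 0%N) ->
    [forall s, ~~ touched Gamma beta h s ==>
      (exponent y s == circle_sum beta (u + v) s)] = off.
  move=> v0; rewrite offE; apply: eq_forallb => s; apply: implyb_id2l => un.
  by rewrite circle_sumD v0 // addn0.
have totx : total h x = touched_sum beta h u.
  by rewrite -(touched_sum_toggled u tog) /total /touched_sum !exE.
have monoE v : (forall s, ~~ touched Gamma beta h s -> circle_sum beta v s = 0%N) ->
   mono beta (u + v) y = [&& off, exponent y (left h) == circle_sum beta (u + v) (left h)
    & exponent y (right h) == circle_sum beta (u + v) (right h)]%:R.
  by move=> v0; rewrite (mono_split h _ tyE) offE'.
rewrite totx /total /touched_sum tyE.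
have := joined_toggled tog; rewrite /step_type.
have [jb|njb] := boolP (joined Gamma beta h); last first.
  rewrite orbF => ja; rewrite ja /= sum_ffunE.
  under eq_bigr => i _.
    rewrite monoE; last by move=> s un; rewrite circle_sumD !untouched_unit.
    rewrite !circle_sumD !circle_sum_unit !same_circle_refl.
    rewrite (same_circle_sym _ _ (right h)) (negbTE (njb : ~~ same_circle _ _ _ _)).
    rewrite !mul1n !mul0n add0n addn0.
    over.
  case: (off) => /=; last by rewrite big1.
  have := exponent_lt y (left h); have := exponent_lt y (right h).
  move: (exponent y (left h)) (exponent y (right h)) half_color_lb.
  move: (circle_sum _ _ _) (circle_sum _ _ _) => B A p q lb qn pn.
  rewrite mul1r; have [pq|pq] := eqVneq; last first.
    rewrite big1 // => i _; have ilt := ltn_ord i.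
    by case: andP => // -[/eqP ? /eqP ?]; case/eqP: pq; lia.
  (* Only i = p - A can contribute. It is in range, and A <= p, because p and q are less than n <=
     2m + 1. *)
  have ip : (p - A < m.*2.+1)%N by lia.
  rewrite (bigD1 (Ordinal ip)) //= big1 ?addr0.
    by rewrite [X in nat_of_bool X](_ : _ = true) //=; lia.
  move=> i /eqP iN; case: andP => // -[/eqP pE _]; case: iN.
  by apply: val_inj => /=; lia.
move=> _; have jbE v : (exponent y (left h) == circle_sum beta v (left h)) &&
    (exponent y (right h) == circle_sum beta v (right h)) =
    (exponent y (left h) == circle_sum beta v (left h)).
  by rewrite -(exponent_circle_sum v tyE jb) andbb.
rewrite /step_type !addn0; case: (joined Gamma alpha h) => /=.
  rewrite ffunE monoE; last by move=> s un; rewrite untouched_unit.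
  rewrite jbE circle_sumD circle_sum_unit same_circle_refl mul1n muln1 expr1.
  by case: (off) => /=; rewrite ?scaler0.
rewrite -[X in mono _ X](addr0 u) monoE; last first.
  by move=> s _; rewrite /circle_sum big1 // => t _; rewrite ffunE.
rewrite jbE addr0 muln0 addn0 expr0 mul1r.
by case: (off).
Qed.

End EdgeMaps.

Arguments mono_move {G Gamma n k alpha} u {s t} i _.
Arguments mono_eq0 {G Gamma n k alpha u s} _.
Arguments mono_tag {G Gamma n k alpha} v {y} _.
Arguments edge_map_mono {G Gamma n k} sqrtn n_gt0 {h alpha} u _.

(** * Edge maps commute *)

Section EdgeMapsCommute.
Variables (G : multigraph) (Gamma : ribbon G) (n : nat).
Variables (k : comNzRingType) (sqrtn : k).
Hypothesis n_gt0 : (0 < n)%N.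
Hypothesis sqrtn2 : sqrtn ^+ 2 = n%:R.
Implicit Types (alpha beta : state G) (h : half_edge G) (s : side G) (t : nat).

Local Notation m := (half_color n).
Local Notation left h := ((inl h, true) : side G).
Local Notation right h := ((inl h, false) : side G).
Notation exps := ({ffun side G -> nat}).
Implicit Types (u v : exps) (w : chain Gamma n k) (phi psi : exps -> chain Gamma n k).
Local Notation mono := (@mono G Gamma n k).

HB.instance Definition _ h :=
  GRing.isLinear.Build k (chain Gamma n k) (chain Gamma n k) *:%R
    (edge_map sqrtn h) (edge_map_is_linear sqrtn h).

Lemma edge_map_raised h alpha w : alpha h ->
  (forall x, tag x != alpha -> w x = 0) -> edge_map sqrtn h w = 0 :> chain Gamma n k.
Proof.
move=> ah w0; apply/ffunP=> y; rewrite !ffunE big1 // => x _.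
have [e|/w0->] := eqVneq (tag x) alpha; last by rewrite mulr0.
by rewrite edge_coefE // e ah /= mul0r.
Qed.

Lemma twist_op_linear (L : {linear chain Gamma n k -> chain Gamma n k}) h t phi u :
  L (twist_op sqrtn h t phi u) = twist_op sqrtn h t (fun v => L (phi v)) u.
Proof. by case: t => [|[|t]] //=; rewrite ?linearZ // linear_sum. Qed.

Lemma eq_twist_op h t phi psi u : phi =1 psi ->
  twist_op sqrtn h t phi u = twist_op sqrtn h t psi u :> chain Gamma n k.
Proof.
move=> e; case: t => [|[|t]] //=; rewrite ?e //.
by apply: eq_bigr => i _; rewrite e.
Qed.

(** Multiplications commute when the types are fixed; difficulties arise only when the order of the
    steps changes the types. *)
Lemma twist_opC h h' t t' phi u :
  twist_op sqrtn h t (twist_op sqrtn h' t' phi) u =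
  twist_op sqrtn h' t' (twist_op sqrtn h t phi) u :> chain Gamma n k.
Proof.
case: t t' => [|[|t]] [|[|t']] //=.
- by rewrite addrAC scalerA mulrC -scalerA.
- by rewrite scaler_sumr; apply: eq_bigr => i _; rewrite addrAC.
- by rewrite scaler_sumr; apply: eq_bigr => i _; rewrite addrAC.
- rewrite exchange_big; apply: eq_bigr => i _; apply: eq_bigr => j _.
  by rewrite addrAC.
Qed.

Lemma mono_move2 alpha u s s' (t t' : side G) i j :
  same_circle Gamma alpha s s' -> same_circle Gamma alpha t t' ->
  mono alpha (u + (unit_exp s *+ i + unit_exp t *+ j)) =
  mono alpha (u + (unit_exp s' *+ i + unit_exp t' *+ j)).
Proof.
move=> ss tt.
by rewrite addrA (mono_move _ _ tt) addrAC (mono_move _ _ ss) addrAC -addrA.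
Qed.

Local Arguments mono_move2 {alpha} u {s s' t t'} i j _ _.

(** With both sides of [h] on one circle, type t multiplies by the t-th power of sqrt n x^m, so only
    the sum of the types of a composite matters there. *)
Lemma twist_op_joined alpha h t u : joined Gamma alpha h -> (t <= 2)%N ->
  twist_op sqrtn h t (mono alpha) u =
  sqrtn ^+ t *: mono alpha (u + unit_exp (left h) *+ (m * t)).
Proof.
move=> j; case: t => [|[|[|//]]] _ /=.
- by rewrite muln0 mulr0n addr0 scale1r.
- by rewrite muln1.
transitivity (\sum_(i < m.*2.+1) mono alpha (u + unit_exp (left h) *+ (m * 2))).
  apply: eq_bigr => i _.
  rewrite (mono_move2 (s' := left h) (t' := left h) u) ?same_circle_refl //; last first.
    by rewrite same_circle_sym.
  by rewrite -mulrnDr subnKC ?muln2 // -ltnS.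
rewrite sumr_const card_ord sqrtn2 scaler_nat.
(* For odd n the number 2m+1 of terms is n; for even n each term contains x^(2m) = x^n = 0. *)
have [->//|/half_color_even big] := eqVneq m.*2.+1 n.
rewrite (mono_eq0 (s := left h)) ?mul0rn //.
by rewrite circle_sumD circle_sum_unit same_circle_refl mul1n muln2; lia.
Qed.

(** The difference of the two sides telescopes to x_l^(2m+1) - x_r^(2m+1), and both powers
    vanish. *)
Lemma telescope_move alpha h u :
  twist_op sqrtn h 2 (mono alpha) (u + unit_exp (left h)) =
  twist_op sqrtn h 2 (mono alpha) (u + unit_exp (right h)).
Proof.
rewrite /= big_ord_recr [RHS]big_ord_recl /=.
have lb := half_color_lb n.
rewrite (mono_eq0 (s := left h)) ?addr0; last first.
  rewrite !circle_sumD !circle_sum_unit -[unit_exp _]mulr1n circle_sum_unit.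
  by rewrite same_circle_refl; lia.
rewrite [X in _ = X + _](mono_eq0 (s := right h)) ?add0r; last first.
  rewrite !circle_sumD !circle_sum_unit -[unit_exp _]mulr1n circle_sum_unit.
  by rewrite same_circle_refl; lia.
apply: eq_bigr => i _; congr (mono _ _); rewrite /bump /= add1n.
rewrite -!addrA; congr (_ + _); rewrite addrA -mulrS addrCA; congr (_ + _).
by rewrite -mulrS subnSK.
Qed.

Lemma twist_op_move alpha h u i :
  twist_op sqrtn h 2 (mono alpha) (u + unit_exp (left h) *+ i) =
  twist_op sqrtn h 2 (mono alpha) (u + unit_exp (right h) *+ i).
Proof.
elim: i u => [|i IHi] u; first by rewrite !mulr0n.
by rewrite !mulrS !addrA IHi [u + _ + _]addrAC telescope_move [u + _ + _]addrAC.
Qed.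

Lemma twist_op2_same alpha h u s s2 i : same_circle Gamma alpha s s2 ->
  twist_op sqrtn h 2 (mono alpha) (u + unit_exp s *+ i) =
  twist_op sqrtn h 2 (mono alpha) (u + unit_exp s2 *+ i).
Proof.
move=> st; apply: eq_bigr => j _.
by rewrite addrAC (mono_move _ _ st) addrAC.
Qed.

(** The factor of Delta is symmetric in its two variables, so it depends only on the unordered pair
    of circles. *)
Lemma twist_op2_match alpha h1 h2 :
  let e := same_circle Gamma alpha in
  e (left h1) (left h2) && e (right h1) (right h2) ||
  e (left h1) (right h2) && e (right h1) (left h2) ->
  twist_op sqrtn h1 2 (mono alpha) =1 twist_op sqrtn h2 2 (mono alpha).
Proof.
move=> e /orP[] /andP[ll rr] u /=.
  by apply: eq_bigr => i _; rewrite (mono_move2 _ _ _ ll rr).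
rewrite [LHS](reindex_inj rev_ord_inj) /=; apply: eq_bigr => i _.
have ile : (i <= m.*2)%N by rewrite -ltnS.
by rewrite (mono_move2 _ _ _ ll rr) subSS subKn // [unit_exp _ *+ (m.*2 - i) + _]addrC.
Qed.

Lemma twist_op_square alpha h1 h2 t u : (t < 2)%N ->
  let e := same_circle Gamma alpha in
  e (left h1) (left h2) && e (right h1) (right h2) ||
  e (left h1) (right h2) && e (right h1) (left h2) ->
  twist_op sqrtn h1 t (twist_op sqrtn h2 2 (mono alpha)) u =
  twist_op sqrtn h2 t (twist_op sqrtn h1 2 (mono alpha)) u.
Proof.
move=> t2 e eh; have [->|->] : t = 0%N \/ t = 1%N by lia.
  exact: esym (twist_op2_match eh u).
change (sqrtn *: twist_op sqrtn h2 2 (mono alpha) (u + unit_exp (left h1) *+ m) =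
        sqrtn *: twist_op sqrtn h1 2 (mono alpha) (u + unit_exp (left h2) *+ m)).
rewrite (twist_op2_match eh); apply: congr1.
(* If the left side of [h1] is on the circle of the right side of [h2], the factor x^m has to cross
   to the other circle; multiplied by the factor of Delta it may. *)
case/orP: eh => /andP[e1 _]; rewrite (twist_op2_same _ _ _ e1); first exact: erefl.
exact: esym (twist_op_move _ _ _ _).
Qed.

Lemma step_type_le2 h alpha beta : (step_type Gamma alpha beta h <= 2)%N.
Proof. by rewrite /step_type; do 2!case: joined. Qed.

Lemma raiseC alpha h1 h2 : raise (raise alpha h1) h2 = raise (raise alpha h2) h1.
Proof. by apply/ffunP=> h; rewrite !ffunE orbCA. Qed.

(** [h2] may be [opp h1]: the constraints of the finite check follow from [toggled] alone, whether
    or not the four sides belong to different edges. *)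
Lemma edge_map_square alpha h1 h2 u : ~~ alpha h1 -> ~~ alpha h2 -> h1 != h2 ->
  edge_map sqrtn h2 (edge_map sqrtn h1 (mono alpha u)) =
  edge_map sqrtn h1 (edge_map sqrtn h2 (mono alpha u)).
Proof.
move=> a1 a2 ne.
have a12 : ~~ raise alpha h1 h2 by rewrite ffunE eq_sym (negbTE ne).
have a21 : ~~ raise alpha h2 h1 by rewrite ffunE (negbTE ne).
rewrite (edge_map_mono sqrtn n_gt0 u a1) (edge_map_mono sqrtn n_gt0 u a2) !twist_op_linear.
rewrite (eq_twist_op _ _ _ (fun v => edge_map_mono _ n_gt0 v a12)).
rewrite (eq_twist_op _ _ _ (fun v => edge_map_mono _ n_gt0 v a21)).
rewrite (raiseC alpha h2 h1); set al12 := raise _ h2.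
pose f := fp_of Gamma h1 h2.
have : fp_square (f alpha) (f (raise alpha h1)) (f (raise alpha h2)) (f al12).
  apply: fp_squareP; rewrite ?fp_of_trans //.
  - exact/fp_of_step1/raise_toggled.
  - exact/fp_of_step2/raise_toggled.
  - exact/fp_of_step2/raise_toggled.
  - by rewrite /al12 raiseC; apply/fp_of_step1/raise_toggled.
rewrite /fp_square /fp_type1 /fp_type2 /f /=.
rewrite -!/(joined Gamma _ h1) -!/(joined Gamma _ h2) -!/(step_type Gamma _ _ h1).
rewrite -!/(step_type Gamma _ _ h2).
have lt1 := step_type_le2 h1 alpha (raise alpha h1).
have lt1' := step_type_le2 h1 (raise alpha h2) al12.
have lt2 := step_type_le2 h2 alpha (raise alpha h2).
have lt2' := step_type_le2 h2 (raise alpha h1) al12.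
move: (step_type _ alpha (raise alpha h1) h1) lt1 => t1 lt1.
move: (step_type _ (raise alpha h2) al12 h1) lt1' => t1' lt1'.
move: (step_type _ alpha (raise alpha h2) h2) lt2 => t2 lt2.
move: (step_type _ (raise alpha h1) al12 h2) lt2' => t2' lt2'.
case/or3P.
- by case/andP=> /eqP-> /eqP->; rewrite twist_opC.
(* All four sides end on one circle. Each composite multiplies by the power of sqrt n x^m given by
   its total type, and the totals agree. *)
- case/and4P=> j1 j2 j12 /eqP tE.
  rewrite (eq_twist_op _ _ _ (fun v => twist_op_joined v j2 lt2')).
  rewrite (eq_twist_op _ _ _ (fun v => twist_op_joined v j1 lt1')).
  have Z h t c : twist_op sqrtn h t (fun v =>
      sqrtn ^+ c *: mono al12 (v + unit_exp (left h1) *+ (m * c))) u =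
     sqrtn ^+ c *: twist_op sqrtn h t (mono al12) (u + unit_exp (left h1) *+ (m * c)).
    case: t => [|[|t]] //=.
      by rewrite scalerA mulrC -scalerA addrAC.
    by rewrite scaler_sumr; apply: eq_bigr => i _; rewrite addrAC.
  have jE v i : mono al12 (v + unit_exp (left h2) *+ i) =
      mono al12 (v + unit_exp (left h1) *+ i).
    by rewrite (mono_move _ _ j12).
  rewrite (@eq_twist_op h1 t1 _ (fun v =>
    sqrtn ^+ t2' *: mono al12 (v + unit_exp (left h1) *+ (m * t2'))) u).
    rewrite !Z (twist_op_joined _ j1 lt1) (twist_op_joined _ j2 lt2) jE.
    rewrite -!addrA -!mulrnDr -!mulnDr !scalerA -!exprD.
    by rewrite (addnC t2' t1) tE (addnC t1').
  by move=> v; rewrite jE.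
- case/and5P=> /eqP<- t1lt /eqP-> /eqP-> eh; exact: twist_op_square.
Qed.

Lemma chain_eq_mono (w : chain Gamma n k) : exists (r : gen Gamma n -> exps),
  w = \sum_x (w x : k) *: mono (tag x) (r x).
Proof.
(* The exponent of a circle is placed on its root only, so the sum over the circle counts it
   once. *)
exists (fun x : gen Gamma n => [ffun s =>
  if fingraph.root (arc Gamma (tag x)) s == s then exponent x s else 0%N]).
have csE (x : gen Gamma n) s : circle_sum Gamma (tag x) [ffun t =>
    if fingraph.root (arc Gamma (tag x)) t == t then exponent x t else 0%N] s = exponent x s.
  set rt := fingraph.root (arc Gamma (tag x)) s.
  have srt : same_circle Gamma (tag x) s rt by apply: connect_root.
  have sc := same_circle_sym Gamma (tag x).
  rewrite /circle_sum (bigD1 rt) // ffunE (eqP (roots_root sc s)) eqxx big1.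
    by rewrite [LHS](addn0 (exponent x rt)); apply/esym/exponent_same.
  move=> t /andP[st tr]; rewrite ffunE ifN //; apply: contra tr => /eqP tE.
  by rewrite -tE; apply/eqP/(fingraph.rootP sc); rewrite -/(same_circle _ _ _ _) same_circle_sym.
apply/ffunP=> y; rewrite sum_ffunE (bigD1 y) //= big1 ?addr0.
  rewrite !ffunE eqxx /= (_ : [forall s, _] = true) ?[_ *: _]mulr1 //.
  by apply/forallP=> s; rewrite csE.
move=> x xy; rewrite !ffunE; case: andP => [[/eqP tE /forallP e]|_]; last exact: mulr0.
case/eqP: xy; apply: gen_eq => // s; apply/esym/eqP.
by have := e s; rewrite csE.
Qed.

(** On a summand where [h1] or [h2] is already raised both composites vanish. So commutation holds
    for all chains, and paths can be permuted without tracking states. *)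
Lemma edge_mapC h1 h2 (w : chain Gamma n k) :
  edge_map sqrtn h2 (edge_map sqrtn h1 w) = edge_map sqrtn h1 (edge_map sqrtn h2 w).
Proof.
have [->//|ne] := eqVneq h1 h2.
have [r ->] := chain_eq_mono w; rewrite !linear_sum; apply: eq_bigr => x _.
rewrite !linearZ /=; congr (_ *: _); move: (tag x) (r x) => alpha u.
have z h h' : h != h' -> alpha h -> edge_map sqrtn h (edge_map sqrtn h' (mono alpha u)) = 0.
  move=> hh ah; have [a'|a'] := boolP (alpha h').
    rewrite (edge_map_raised a') ?linear0 // => y; exact: mono_tag.
  apply: (edge_map_raised (alpha := raise alpha h')).
    by rewrite ffunE ah orbT.
  move=> y ty; rewrite ffunE big1 // => z _; rewrite edge_coefE.
  have [tz|tz] := eqVneq (tag z) alpha; last by rewrite mono_tag ?mulr0.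
  by rewrite tz (negbTE ty) andbF mul0r.
have zz h h' : alpha h -> edge_map sqrtn h' (edge_map sqrtn h (mono alpha u)) = 0.
  move=> ah; rewrite (edge_map_raised ah) ?linear0 // => y; exact: mono_tag.
have [a1|a1] := boolP (alpha h1); first by rewrite zz // z.
have [a2|a2] := boolP (alpha h2); first by rewrite (zz h2 h1 a2) z // eq_sym.
exact: edge_map_square.
Qed.

Lemma compose_path_cat p1 p2 w :
  compose_path sqrtn (p1 ++ p2) w = compose_path sqrtn p2 (compose_path sqrtn p1 w).
Proof. exact: foldl_cat. Qed.

Lemma edge_map_compose h hs w :
  edge_map sqrtn h (compose_path sqrtn hs w) = compose_path sqrtn hs (edge_map sqrtn h w).
Proof.
elim: hs w => //= h' hs IHhs w.
by rewrite /compose_path /= -!/(compose_path sqrtn _ _) IHhs edge_mapC.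
Qed.

Lemma compose_pathC p1 p2 w :
  compose_path sqrtn p1 (compose_path sqrtn p2 w) =
  compose_path sqrtn p2 (compose_path sqrtn p1 w).
Proof.
elim: p1 w => //= h p1 IHs w.
by rewrite /compose_path /= -!/(compose_path sqrtn _ _) edge_map_compose IHs.
Qed.

Lemma compose_path_perm p1 p2 w : perm_eq p1 p2 ->
  compose_path sqrtn p1 w = compose_path sqrtn p2 w.
Proof.
move=> p12.
apply: (catCA_perm_ind (P := fun p => compose_path sqrtn p1 w = compose_path sqrtn p w) _ p12).
  by move=> r1 r2 r3 ->; rewrite !compose_path_cat (compose_pathC r2 r1).
by [].
Qed.

End EdgeMapsCommute.

(** * The differential *)

Section Differential.
Variables (G : multigraph) (Gamma : ribbon G) (n : nat).
Variables (k : comNzRingType) (sqrtn : k).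
Hypothesis n_gt0 : (0 < n)%N.
Hypothesis sqrtn2 : sqrtn ^+ 2 = n%:R.
Implicit Types (alpha beta : state G) (h : half_edge G) (s : side G).
Implicit Types (w : chain Gamma n k) (x y : gen Gamma n).
Implicit Types (nu : {ffun vertex G -> bool}) (u v : vertex G).

Local Notation m := (half_color n).

Lemma weight_raise alpha h : ~~ alpha h ->
  weight (raise alpha h) = (weight alpha).+1.
Proof.
move=> a0; rewrite /weight (bigD1 h) //= [in RHS](bigD1 h) //= ffunE eqxx.
rewrite (negbTE a0) add0n add1n; congr S; apply: eq_bigr => h' ne.
by rewrite ffunE (negbTE ne).
Qed.

(** Unaffected circles are equal as sets of sides but belong to different types; [f] and [g] match
    them through representatives. *)
Lemma sum_unaffected h x y : toggled Gamma h (tag x) (tag y) -> same_off h x y ->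
  \sum_(c | c \notin affected Gamma h (tag x)) (m%:Z - (tagged x c)%:Z) =
  \sum_(c | c \notin affected Gamma h (tag y)) (m%:Z - (tagged y c)%:Z).
Proof.
move=> tog /(same_offP tog) so.
pose f (c : circle Gamma (tag y)) := circle_of Gamma (tag x) (circle_rep c).
pose g (c : circle Gamma (tag x)) := circle_of Gamma (tag y) (circle_rep c).
have afE al t : (circle_of Gamma al t \in affected Gamma h al) = touched Gamma al h t.
  by rewrite !inE touchesE.
have fg c : c \notin affected Gamma h (tag x) -> f (g c) = c.
  have [t ->] := circle_ofP c; rewrite afE => un; apply/eqP; rewrite circle_of_eq.
  have un' : ~~ touched Gamma (tag x) h (circle_rep (circle_of Gamma (tag x) t)).
    by rewrite (touched_same _ (same_circle_rep _ _ _)).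
  apply: same_circle_trans (same_circle_rep _ _ _).
  by rewrite same_circle_sym (untouched_same tog un') same_circle_sym same_circle_rep.
rewrite (reindex_onto f g fg); apply: eq_big => c.
  have [t ->] := circle_ofP c; rewrite !afE -(touched_same _ (same_circle_rep _ _ t)).
  rewrite (touched_toggled tog); case: (boolP (touched _ _ _ _)) => //= un.
  rewrite circle_of_eq; set r := circle_rep (circle_of _ (tag y) t) in un *.
  have un' : ~~ touched Gamma (tag x) h r by rewrite (touched_toggled tog).
  apply: (same_circle_trans (y := r)); last exact: same_circle_rep.
  rewrite same_circle_sym -(untouched_same tog un') same_circle_sym.
  exact: same_circle_rep.
rewrite afE => /andP[un _]; congr (_ - _%:Z).
by rewrite -[c in RHS]circle_repK; apply: so un.
Qed.

(** If c affected circles become c', the total exponent grows by m (c' - c + 1). The part m (c' - c)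
    balances the change of circles, the last m the shift by m |alpha|. *)
Lemma gdeg_edge_coef h x y : edge_coef sqrtn h x y != 0 -> gdeg x = gdeg y.
Proof.
have := sum_affected h x; have := sum_affected h y.
rewrite /edge_coef; set b := (\sum_(c in _) _)%N; set a := (\sum_(c in _) _)%N => bE aE.
case: ifP => [/and3P[x0 /eqP ty so]|_]; last by rewrite eqxx.
have tog : toggled Gamma h (tag x) (tag y) by rewrite ty; apply: raise_toggled.
have split (z : gen Gamma n) : \sum_c (m%:Z - (tagged z c)%:Z) =
   m%:Z * #|affected Gamma h (tag z)|%:Z
   - (\sum_(c in affected Gamma h (tag z)) tagged z c)%N%:Z
   + \sum_(c | c \notin affected Gamma h (tag z)) (m%:Z - (tagged z c)%:Z).
  rewrite (bigID (mem (affected Gamma h (tag z)))) /=; congr (_ + _).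
  rewrite big_split /= sumr_const sumrN (big_morph Posz PoszD (erefl (Posz 0))).
  by rewrite -mulr_natr natz.
have wy : weight (tag y) = (weight (tag x)).+1 by rewrite ty weight_raise.
rewrite /gdeg !split (sum_unaffected tog so) -/a -/b wy !card_affected mulnS; move: (m * weight _)%N => W.
move: (\sum_(c | _) _) => U {bE aE so}.
case: (joined _ (tag x)); case: (joined _ (tag y)); rewrite ?eqxx //=;
  rewrite /mu_coef /Delta_coef /eta_coef;
  move: a b => a b; case: (b =P _) => [->|_]; rewrite ?mulr0n ?eqxx // => _; lia.
Qed.

Definition in_state alpha w : Prop := forall x, tag x != alpha -> w x = 0.
Definition in_degree (j : int) w : Prop := forall x, gdeg x != j -> w x = 0.

Lemma in_state_edge_map h alpha w : in_state alpha w ->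
  in_state (raise alpha h) (edge_map sqrtn h w).
Proof.
move=> wa y ty; rewrite ffunE big1 // => x _.
have [tx|/wa->] := eqVneq (tag x) alpha; last by rewrite mulr0.
by rewrite edge_coefE tx (negbTE ty) andbF mul0r.
Qed.

Lemma in_degree_edge_map h j w : in_degree j w -> in_degree j (edge_map sqrtn h w).
Proof.
move=> wj y yj; rewrite ffunE big1 // => x _.
have [xj|/wj->] := eqVneq (gdeg x) j; last by rewrite mulr0.
have [->|/gdeg_edge_coef e] := eqVneq (edge_coef sqrtn h x y) 0; first by rewrite mul0r.
by rewrite -e xj eqxx in yj.
Qed.

Lemma in_state_compose p alpha w : in_state alpha w ->
  in_state [ffun h => (h \in p) || alpha h] (compose_path sqrtn p w).
Proof.
elim: p alpha w => [|h p IHp] alpha w wa.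
  suff -> : [ffun h => (h \in [::]) || alpha h] = alpha by [].
  by apply/ffunP=> h; rewrite ffunE.
suff -> : [ffun h0 => (h0 \in h :: p) || alpha h0] =
    [ffun h0 => (h0 \in p) || raise alpha h h0].
  exact/IHp/in_state_edge_map.
by apply/ffunP=> h'; rewrite !ffunE inE orbCA orbA.
Qed.

Lemma in_degree_compose p j w : in_degree j w -> in_degree j (compose_path sqrtn p w).
Proof. by elim: p w => [|h p IHp] w wj //; apply/IHp/in_degree_edge_map. Qed.

Lemma in_state_proj alpha w : in_state alpha (proj_state alpha w).
Proof. by move=> x /negbTE tx; rewrite ffunE tx. Qed.

Lemma in_degree_proj alpha j w : in_degree j w -> in_degree j (proj_state alpha w).
Proof. by move=> wj x /wj xj; rewrite ffunE xj if_same. Qed.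

Lemma proj_in_state alpha beta w : in_state alpha w ->
  proj_state beta w = if beta == alpha then w else 0.
Proof.
move=> wa; apply/ffunP=> x; rewrite ffunE; case: (eqVneq beta) => [->|ne].
  by case: eqVneq => // /wa.
by rewrite ffunE; case: eqVneq => // xb; rewrite wa // xb.
Qed.

Hypothesis tri : trivalent G.

Lemma star_inhabited v : exists h, vert h = v.
Proof.
have : (0 < #|star v|)%N by rewrite tri.
by case/card_gt0P=> h; rewrite inE => /eqP; exists h.
Qed.

(** A state sees a vertex only through its half-edges, of which trivalence provides three. *)
Lemma vstate_inj : injective (@vstate G).
Proof.
move=> nu nu' e; apply/ffunP=> v; have [h <-] := star_inhabited v.
by have /ffunP/(_ h) := e; rewrite !ffunE.
Qed.

Lemma weight_vstate nu : weight (vstate nu) = (3 * weight nu)%N.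
Proof.
rewrite /weight (partition_big (@vert G) predT) //= big_distrr /=.
apply: eq_bigr => v _; rewrite -(tri v) -sum1_card big_distrl /=.
apply: eq_big => [h|h /eqP<-]; first by rewrite inE.
by rewrite ffunE mul1n.
Qed.

Definition vraise nu v : {ffun vertex G -> bool} := [ffun u => (u == v) || nu u].

Variables (ord : vertex G -> 'I_#|vertex G|) (hs : vertex G -> seq (half_edge G)).
Hypotheses (ord_inj : vertex_order ord) (hsP : path_choice hs).

Lemma in_state_vertex nu v w : in_state (vstate nu) w ->
  in_state (vstate (vraise nu v)) (compose_path sqrtn (hs v) w).
Proof.
move=> wn; suff -> : vstate (vraise nu v) = [ffun h => (h \in hs v) || vstate nu h].
  exact: in_state_compose.
by apply/ffunP=> h; rewrite !ffunE (perm_mem (hsP v)) mem_enum inE.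
Qed.

Lemma compose_path0 p : compose_path sqrtn p 0 = 0 :> chain Gamma n k.
Proof. by elim: p => //= h p IHp; rewrite /compose_path /= linear0. Qed.

Lemma delta_in_state nu w : in_state (vstate nu) w ->
  delta sqrtn ord hs w = \sum_(v | ~~ nu v)
    (-1) ^+ before ord nu v *: compose_path sqrtn (hs v) w.
Proof.
move=> wn; rewrite /delta (bigD1 nu) //= [X in _ + X]big1 ?addr0.
  by apply: eq_bigr => v _; rewrite (proj_in_state _ wn) eqxx.
move=> nu' ne; rewrite big1 // => v _.
by rewrite (proj_in_state _ wn) (inj_eq vstate_inj) (negbTE ne) compose_path0 scaler0.
Qed.

Lemma before_vraise nu v u : ~~ nu v ->
  before ord (vraise nu v) u = (before ord nu u + (ord v < ord u))%N.
Proof.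
move=> nv; rewrite /before; have [lt|ge] := boolP (ord v < ord u)%N; last first.
  rewrite addn0; apply: eq_bigr => u' lt; rewrite ffunE.
  by case: eqVneq => // e; rewrite -e lt in ge.
rewrite (bigD1 v) //= ffunE eqxx [in RHS](bigD1 v) //= (negbTE nv) add0n addn1 add1n.
by congr S; apply: eq_bigr => u' /andP[_ /negbTE ne]; rewrite ffunE ne.
Qed.

(** The two orders of raising u and v give the same composite by commutation. Their signs are
    opposite, because raising the earlier vertex first adds one to the count before the later
    one. *)
Lemma delta_delta w : delta sqrtn ord hs (delta sqrtn ord hs w) = 0.
Proof.
rewrite [X in delta _ _ _ X]/delta linear_sum big1 // => nu _ /=.
set x := proj_state _ w.
have xn : in_state (vstate nu) x by apply: in_state_proj.
pose T v u := (-1) ^+ (before ord nu v + before ord nu u + (ord v < ord u))%N *: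
  compose_path sqrtn (hs u) (compose_path sqrtn (hs v) x).
pose C v u := [&& ~~ nu v, ~~ nu u & u != v].
rewrite linear_sum (eq_bigr (fun v => \sum_(u | C v u) T v u)); last first.
  move=> v nv; rewrite linearZ /= (delta_in_state (in_state_vertex (v := v) xn)) scaler_sumr.
  apply: eq_big => [u|u _]; first by rewrite /C ffunE negb_or nv andbC.
  by rewrite scalerA -exprD before_vraise // addnA.
pose S := \sum_v \sum_(u | C v u && (ord v < ord u)%N) T v u.
have -> : \sum_(v | ~~ nu v) \sum_(u | C v u) T v u =
    S + \sum_v \sum_(u | C v u && (ord u < ord v)%N) T v u.
  rewrite -big_split big_mkcond; apply: eq_bigr => v _ /=.
  case: ifP => nv; last first.
    by rewrite !big_pred0 ?addr0 // => u; rewrite /C nv.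
  rewrite (bigID (fun u => ord v < ord u)%N) /=; congr (_ + _); apply: eq_bigl => u.
  rewrite -leqNgt leq_eqVlt /C; case: (eqVneq u v) => [->|ne]; first by rewrite !andbF.
  by rewrite (_ : (_ == _ :> nat) = false) //; apply: contraNF ne => /eqP/val_inj/ord_inj->.
rewrite /S [X in _ + X](exchange_big_dep predT) //= -big_split big1 // => v _ /=.
rewrite [X in _ + X](eq_bigl (fun u => C v u && (ord v < ord u)%N)); last first.
  by move=> u; rewrite /C eq_sym andbCA.
rewrite -big_split big1 // => u /andP[_ lt] /=.
rewrite /T (compose_pathC n_gt0 sqrtn2 (hs u)) lt (ltnNge (ord u)) (ltnW lt) /=.
by rewrite addn0 (addnC (before _ _ u)) exprD mulrN1 scaleNr addNr.
Qed.

Lemma homogeneousP i j w : reflect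
  (in_degree j w /\ forall x, w x != 0 -> exists2 nu, tag x = vstate nu & (weight nu)%:Z = i)
  (w \in homogeneous Gamma n k i j).
Proof.
apply: (iffP forallP) => [H|[wj wi] x].
  have H' x : w x != 0 -> bidegree i j x.
    by move=> nz; move: (H x) nz; case: bidegree => //= ->.
  split=> [x|x /H'/andP[/existsP[nu /andP[/eqP tx /eqP wn]] _]]; last by exists nu.
  by move=> xj; apply/eqP; apply: contraR xj => /H'/andP[].
apply/implyP; apply: contraNT => nz; apply/andP; split.
  have [nu tx wn] := wi x nz; apply/existsP; exists nu.
  by rewrite tx wn !eqxx.
by apply: contraR nz => /wj/eqP.
Qed.

Lemma weight_vraise nu v : ~~ nu v -> weight (vraise nu v) = (weight nu).+1.
Proof.
move=> nv; rewrite /weight (bigD1 v) //= [in RHS](bigD1 v) //= ffunE eqxx.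
rewrite (negbTE nv) add0n add1n; congr S; apply: eq_bigr => u ne.
by rewrite ffunE (negbTE ne).
Qed.

Lemma delta_homogeneous i j w : w \in homogeneous Gamma n k i j ->
  delta sqrtn ord hs w \in homogeneous Gamma n k (i + 1) j.
Proof.
move=> /homogeneousP[wj wi]; rewrite /delta; apply: rpred_sum => nu _.
apply: rpred_sum => v nv; apply: rpredZ; apply/homogeneousP.
split; first exact/in_degree_compose/in_degree_proj.
have [->|p0] := eqVneq (proj_state (vstate nu) w) 0.
  by move=> x; rewrite compose_path0 ffunE eqxx.
have [x] : exists x, proj_state (vstate nu) w x != 0.
  apply/existsP; apply: contraR p0 => /existsPn p0; apply/eqP/ffunP=> x.
  by rewrite [RHS]ffunE; apply/eqP; rewrite -[_ == _]negbK p0.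
rewrite ffunE; case: (tag x =P _) => [tx|_]; last by rewrite eqxx.
case/wi=> nu'; rewrite tx => /vstate_inj <- {nu'} wnu.
have st := in_state_vertex (v := v) (@in_state_proj (vstate nu) w).
move=> y yn; exists (vraise nu v).
  by apply/eqP; apply: contraR yn => /st ->.
by rewrite weight_vraise // -addn1 PoszD wnu.
Qed.

End Differential.

(** * Dimension functions and complexes *)

Section Submodule.
Variables (k : pzRingType) (M : lmodType k) (N : submodClosed M).

Definition sub_lmod : Type := {x : M | zmod_of N x}.
HB.instance Definition _ := [isSub of sub_lmod for @sval M (zmod_of N)].
HB.instance Definition _ := [Choice of sub_lmod by <:].
HB.instance Definition _ := [SubChoice_isSubLmodule of sub_lmod by <:].

Definition quot_proj (x : M) : quot_lmod N := \pi_(Quotient.quot (zmod_of_pred N)) x.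

Fact quot_proj_is_linear : linear quot_proj.
Proof.
move=> a x y; rewrite /quot_proj quot_piD; congr (_ + _).
exact: esym (pi_quot_scale N a x).
Qed.
HB.instance Definition _ :=
  GRing.isLinear.Build k M (quot_lmod N) *:%R quot_proj quot_proj_is_linear.

Lemma quot_proj_eq0 x : quot_proj x = 0 <-> x \in N.
Proof.
have e : (quot_proj x == 0) = (x \in N).
  transitivity (x - 0 \in zmod_of_pred N); last by rewrite subr0.
  rewrite Quotient.idealrBE -[in LHS](linear0 quot_proj).
  exact: erefl.
by rewrite -e; split=> /eqP.
Qed.

Lemma quot_proj_surj y : exists x, quot_proj x = y.
Proof. by elim/quot_lmodW: y => x; exists x. Qed.

End Submodule.

Section DimensionFunction.
Variables (k : comNzRingType) (dim : lmodType k -> rat).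
Hypothesis dimP : dimension_function dim.

Lemma sub_fin_gen_inj (M N : lmodType k) (f : {linear M -> N}) :
  injective f -> sub_fin_gen N -> sub_fin_gen M.
Proof.
move=> fi [P [g [d [h [gi hs]]]]].
exists P, (g \o f), d, h; split=> //; exact: inj_comp.
Qed.

Lemma sub_fin_gen_rV d : sub_fin_gen ('rV[k]_d).
Proof. by exists 'rV[k]_d, idfun, d, idfun; split=> // y; exists y. Qed.

(** For M = 0 the identity maps form a short exact sequence from M to M to M, so additivity gives
    dim M = dim M + dim M. *)
Lemma dim_trivial (M : lmodType k) : (forall x : M, x = 0) -> dim M = 0.
Proof.
move=> M0; have fg : sub_fin_gen M.
  apply: (@sub_fin_gen_inj _ 'rV[k]_0 (\0 : {linear M -> 'rV[k]_0})).
    by move=> x y _; rewrite (M0 x) (M0 y).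
  exact: sub_fin_gen_rV.
have [_ /(_ M M M idfun idfun fg)] := dimP.
move=> /(_ (fun x y e => e)) H.
have e : dim M = dim M + dim M.
  apply: H => [x|z]; last by exists z.
  by split=> _; [exists x | exact: M0].
by apply: (addrI (dim M)); rewrite addr0 -e.
Qed.

End DimensionFunction.

Section SupportedDimension.
Variables (G : multigraph) (Gamma : ribbon G) (n : nat) (k : comNzRingType).
Local Notation chain := (chain Gamma n k).

Definition supported_submod (P : pred (gen Gamma n)) : submodClosed chain :=
  GRing.SubmodClosed.clone k chain (supported P) _.

Lemma supportedP P (w : chain) :
  reflect (forall x, ~~ P x -> w x = 0) (w \in supported_submod P).
Proof.
apply: (iffP forallP) => [H x Px|H x]; first by have := H x; rewrite Px => /eqP.
by apply/implyP=> /H->.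
Qed.

Definition chain_of_row (v : 'rV[k]_#|gen Gamma n|) : chain :=
  [ffun x => v 0 (enum_rank x) : k].

Fact chain_of_row_linear : linear chain_of_row.
Proof. by move=> a u v; apply/ffunP=> x; rewrite !ffunE !mxE. Qed.
HB.instance Definition _ := GRing.isLinear.Build k _ chain *:%R
  chain_of_row chain_of_row_linear.

Lemma sub_fin_gen_chain : sub_fin_gen chain.
Proof.
exists chain, idfun, #|gen Gamma n|, chain_of_row; split=> // w.
exists (\row_i (w (enum_val i) : k)); apply/ffunP=> x.
by rewrite ffunE mxE enum_rankK.
Qed.

Lemma sub_fin_gen_sub (N : submodClosed chain) : sub_fin_gen (sub_lmod N).
Proof.
by apply: (@sub_fin_gen_inj _ _ _ (val : {linear sub_lmod N -> chain}));
  [exact: val_inj | exact: sub_fin_gen_chain].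
Qed.


Variable dim : lmodType k -> rat.
Hypothesis dimP : dimension_function dim.

(** Evaluation at a point x of P maps onto k, with kernel the chains supported on P without x. *)
Lemma dim_supported P : dim (sub_lmod (supported_submod P)) = #|P|%:R.
Proof.
elim: {P}_.+1 {-2}P (ltnSn #|P|) => // d IHd P; rewrite ltnS => Pd.
have [x Px|P0] := pickP P; last first.
  rewrite eq_card0 // (dim_trivial dimP) // => w; apply: val_inj; apply/ffunP=> x.
  by rewrite (supportedP _ _ (valP w)) ?P0 // ffunE.
pose Q := [predD1 P & x].
have QP (w : sub_lmod (supported_submod Q)) : zmod_of (supported_submod P) (val w).
  apply/supportedP=> y Py; apply: (supportedP _ _ (valP w)).
  by rewrite inE negb_and Py orbT.
pose f (w : sub_lmod (supported_submod Q)) : sub_lmod (supported_submod P) :=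
  exist _ (val w) (QP w).
have f_lin : linear f by move=> a u v; apply: val_inj.
pose fL : {linear sub_lmod (supported_submod Q) -> sub_lmod (supported_submod P)} :=
  HB.pack f (GRing.isLinear.Build k _ _ *:%R f f_lin).
pose g (w : sub_lmod (supported_submod P)) : k^o := val w x.
have g_lin : linear g by move=> a u v; rewrite /g !ffunE.
pose gL : {linear sub_lmod (supported_submod P) -> k^o} :=
  HB.pack g (GRing.isLinear.Build k _ _ *:%R g g_lin).
have [dim1 /(_ _ _ _ fL gL) ->] := dimP.
- rewrite IHd ?dim1; first by rewrite (cardD1 x P) [x \in P]Px addrC natrD.
  by rewrite (cardD1 x P) [x \in P]Px in Pd.
- exact: sub_fin_gen_sub.
- by move=> u v /(congr1 val) /= e; apply: val_inj.
- move=> w; split=> [gw|[u <-]]; last first.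
    by apply: (supportedP _ _ (valP u)); rewrite inE eqxx.
  have Qw : zmod_of (supported_submod Q) (val w).
    apply/supportedP=> y; rewrite inE negb_and negbK => /orP[/eqP->//|Py].
    exact: (supportedP _ _ (valP w)).
  by exists (exist _ (val w) Qw); apply: val_inj.
- move=> c; pose w : chain := [ffun y => if y == x then c else 0 : k].
  have Pc : zmod_of (supported_submod P) w.
    by apply/supportedP=> y Py; rewrite ffunE; case: eqP => // yx; rewrite yx Px in Py.
  by exists (exist _ w Pc); rewrite /= /g /= ffunE eqxx.
Qed.

End SupportedDimension.

(** * Euler characteristic of a complex *)

Section Complex.
Variables (k : comNzRingType) (dim : lmodType k -> rat).
Hypothesis dimP : dimension_function dim.
Variables (W : lmodType k) (d : {linear W -> W}).
Hypothesis dd : forall w, d (d w) = 0.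
Hypothesis fgW : sub_fin_gen W.

Lemma sub_fin_gen_submod (N : submodClosed W) : sub_fin_gen (sub_lmod N).
Proof.
by apply: (@sub_fin_gen_inj _ _ _ (val : {linear sub_lmod N -> W})); first exact: val_inj.
Qed.

Lemma sub_fin_gen_cycle (C : submodClosed W) : sub_fin_gen (cycle_lmod d C).
Proof.
by apply: (@sub_fin_gen_inj _ _ _ (val : {linear cycle_lmod d C -> W})); first exact: val_inj.
Qed.


Definition boundary_submod (C' C : submodClosed W) : submodClosed (cycle_lmod d C) :=
  GRing.SubmodClosed.clone k (cycle_lmod d C) (@is_boundary k W d C' C) _.

Lemma dim_cycle C' C : dim (cycle_lmod d C) =
  dim (sub_lmod (boundary_submod C' C)) + dim (homology d C' C).
Proof.
have [_ H] := dimP.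
apply: (H _ _ (homology d C' C)
  (val : {linear sub_lmod (boundary_submod C' C) -> cycle_lmod d C})
  (@quot_proj k (cycle_lmod d C) (boundary_submod C' C))).
- exact: sub_fin_gen_cycle.
- exact: val_inj.
- move=> x; split=> [/quot_proj_eq0 Bx|[y <-]]; last exact/quot_proj_eq0/(valP y).
  by exists (exist _ x Bx).
- exact: quot_proj_surj.
Qed.

(** The map d takes C onto the boundaries in C1, and its kernel is the module of cycles. *)
Lemma dim_chain (C C1 : submodClosed W) : (forall w, w \in C -> d w \in C1) ->
  dim (sub_lmod C) =
  dim (cycle_lmod d C) + dim (sub_lmod (boundary_submod C C1)).
Proof.
move=> dC.
have ZC (z : cycle_lmod d C) : zmod_of C (val z) by case/andP: (valP z).
pose f (z : cycle_lmod d C) : sub_lmod C := exist _ (val z) (ZC z).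
have f_lin : linear f by move=> a u v; apply: val_inj.
pose fL : {linear cycle_lmod d C -> sub_lmod C} :=
  HB.pack f (GRing.isLinear.Build k _ _ *:%R f f_lin).
have dZ (w : sub_lmod C) : is_cycle d C1 (d (val w)).
  by apply/andP; rewrite dd dC //; exact: (valP w).
pose z w : cycle_lmod d C1 := exist _ (d (val w)) (dZ w).
have zB w : zmod_of (boundary_submod C C1) (z w).
  by apply/asboolP; exists (val w); first exact: (valP w).
pose g w : sub_lmod (boundary_submod C C1) := exist _ (z w) (zB w).
have g_lin : linear g.
  by move=> a u v; apply: val_inj; apply: val_inj; rewrite /= !linearP.
pose gL : {linear sub_lmod C -> sub_lmod (boundary_submod C C1)} :=
  HB.pack g (GRing.isLinear.Build k _ _ *:%R g g_lin).
have [_ H] := dimP; apply: (H _ _ _ fL gL).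
- exact: sub_fin_gen_submod.
- by move=> u v /(congr1 val) /= e; apply: val_inj.
- move=> w; split=> [/(congr1 val)/(congr1 val) /= dw|[u <-]].
    have Zw : is_cycle d C (val w) by apply/andP; rewrite dw; split; [exact: (valP w) | exact: eqxx].
    by exists (exist _ (val w) Zw); apply: val_inj.
  apply: val_inj; apply: val_inj => /=; case/andP: (valP u) => _ /eqP.
  by [].
- move=> b; case/asboolP: (valP b) => w Cw dw.
  by exists (exist _ w Cw); apply: val_inj; apply: val_inj.
Qed.

Lemma dim_homology_trivial (C' C : submodClosed W) : (forall w, w \in C -> w = 0) ->
  dim (homology d C' C) = 0.
Proof.
move=> C0; apply: (dim_trivial dimP) => y.
have [z <-] := quot_proj_surj y.
suff -> : z = 0 by exact: linear0.
by apply: val_inj; apply: C0; case/andP: (valP z).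
Qed.

(** The boundaries of degree i enter the dimensions of two neighbouring chain modules, with opposite
    signs, and the sum telescopes. *)
Lemma euler_char_complex (C : int -> submodClosed W) (N : nat) :
  (forall i w, w \in C i -> d w \in C (i + 1)) ->
  (forall i w, w \in C i -> (i < 0) || (N%:Z < i) -> w = 0) ->
  \sum_(i < N.+1) (-1) ^+ i * dim (homology d (C (i%:Z - 1)) (C i)) =
  \sum_(i < N.+1) (-1) ^+ i * dim (sub_lmod (C i)).
Proof.
move=> dC C0.
pose b (i : nat) : rat := dim (sub_lmod (boundary_submod (C (i%:Z - 1)) (C i))).
(* The two ends of the telescope: no chains of degree -1 produce boundaries in degree 0, and there
   are no chains at all above N. *)
have triv (i : nat) : (i == 0%N) || (N < i)%N -> b i = 0.
  move=> iE; apply: (dim_trivial dimP) => y; apply: val_inj; apply: val_inj.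
  case/orP: iE => [/eqP i0|Ni]; last first.
    by case/andP: (valP (val y)) => /C0-> //; rewrite ltz_nat Ni orbT.
  case/asboolP: (valP y) => w Cw <-; rewrite (C0 _ _ Cw) ?linear0 //.
  by rewrite i0.
have cE (i : nat) : dim (sub_lmod (C i)) =
    b i + dim (homology d (C (i%:Z - 1)) (C i)) + b i.+1.
  rewrite -dim_cycle /b.
  have -> : i.+1%:Z - 1 = i by rewrite -addn1 PoszD addrK.
  by apply: dim_chain => w; rewrite -addn1 PoszD; apply: dC.
rewrite [RHS](eq_bigr (fun i : 'I_N.+1 => (-1) ^+ i * dim (homology d (C (i%:Z - 1)) (C i))
   + ((-1) ^+ i * b i - (-1) ^+ i.+1 * b i.+1))); last first.
  by move=> i _; rewrite cE exprS; ring.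
rewrite big_split /= -(big_mkord xpredT (fun i => (-1) ^+ i * b i - (-1) ^+ i.+1 * b i.+1)).
rewrite (telescope_sumr_eq (fun i => - ((-1) ^+ i * b i))) //; last first.
  by move=> i _; rewrite opprK addrC.
by rewrite !triv ?ltnSn ?orbT // !mulr0 subrr addr0.
Qed.

End Complex.

(** * The graded Euler characteristic *)

Lemma fsbig_setT_seq (R : Type) (idx : R) (op : Monoid.com_law idx) (T : choiceType)
    (r : seq T) (f : T -> R) : uniq r -> (forall i, i \notin r -> f i = idx) ->
  \big[op/idx]_(i \in @classical_sets.setT T) f i = \big[op/idx]_(i <- r) f i.
Proof.
move=> ur f0; rewrite (fsbigE r) // => [|i _]; last exact: f0.
by apply: eq_bigl => i; rewrite classical_sets.in_setT.
Qed.

Section EulerCharacteristic.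
Variables (G : multigraph) (Gamma : ribbon G) (n : nat).
Variables (k : comNzRingType) (sqrtn : k).
Hypothesis n_gt0 : (0 < n)%N.
Hypothesis sqrtn2 : sqrtn ^+ 2 = n%:R.
Hypothesis tri : trivalent G.
Variables (ord : vertex G -> 'I_#|vertex G|) (hs : vertex G -> seq (half_edge G)).
Hypotheses (ord_inj : vertex_order ord) (hsP : path_choice hs).
Variable dim : lmodType k -> rat.
Hypothesis dimP : dimension_function dim.

Local Notation m := (half_color n).
Local Notation N := #|vertex G|.
Local Notation cst r := (tofrac ((r : rat)%:P : {poly rat})).

Lemma var_q_neq0 : var_q != 0.
Proof. by rewrite /var_q tofrac_eq0 polyX_eq0. Qed.

Lemma weight_le nu : (weight (nu : {ffun vertex G -> bool}) <= N)%N.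
Proof.
by rewrite /weight -sum1_card leq_sum // => v _; case: (nu v).
Qed.

Definition degrees : seq int := undup [seq gdeg x | x : gen Gamma n].

Lemma homogeneous_trivial i j w : w \in homogeneous Gamma n k i j ->
  [|| i < 0, N%:Z < i | j \notin degrees] -> w = 0.
Proof.
move=> /homogeneousP[wj wi] out; apply/ffunP=> x; rewrite [RHS]ffunE.
have [//|/wi[nu _ nui]] := eqVneq (w x) 0.
case/or3P: out => [||jd]; rewrite -?nui ?ltz_nat ?ltn0 //.
  by rewrite ltnNge weight_le.
apply: wj; apply: contraNneq jd => <-.
by rewrite mem_undup; apply/mapP; exists x; rewrite ?mem_enum.
Qed.

Lemma dim_VCH_trivial i j : [|| i < 0, N%:Z < i | j \notin degrees] ->
  dim (VCH Gamma n sqrtn ord hs i j) = 0.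
Proof.
by move=> out; apply: (dim_homology_trivial dimP) => w /homogeneous_trivial; apply.
Qed.

Lemma qdim_VCH i : qdim dim (VCH Gamma n sqrtn ord hs i) =
  \sum_(j <- degrees) var_q ^ j * cst (dim (VCH Gamma n sqrtn ord hs i j)).
Proof.
rewrite /qdim (@fsbig_setT_seq _ _ _ _ degrees) ?undup_uniq // => j jd.
by rewrite dim_VCH_trivial ?jd ?orbT // polyC0 tofrac0 mulr0.
Qed.

Lemma euler_char_VCH : euler_char dim (VCH Gamma n sqrtn ord hs) =
  \sum_(i < N.+1) (-1) ^+ i *
    \sum_(j <- degrees) var_q ^ j * cst (dim (VCH Gamma n sqrtn ord hs i j)).
Proof.
rewrite /euler_char (@fsbig_setT_seq _ _ _ _ [seq Posz i | i <- iota 0 N.+1]).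
- by rewrite big_map -(big_mkord xpredT (fun i => (-1) ^+ i *
    \sum_(j <- degrees) var_q ^ j * cst (dim (VCH Gamma n sqrtn ord hs i j))))
    /index_iota subn0; apply: eq_bigr => i _; rewrite qdim_VCH.
- by rewrite map_inj_uniq ?iota_uniq // => a b [].
- move=> i iN; rewrite qdim_VCH big1 ?mulr0 // => j _.
  rewrite dim_VCH_trivial ?polyC0 ?tofrac0 ?mulr0 //.
  apply: contraR iN; rewrite !negb_or -!leNgt => /and3P[i0 iN _].
  by case: i i0 iN => // i _ iN; rewrite map_f // mem_iota.
Qed.

(** The existential over nu becomes a sum because [vstate] is injective: a generator lies over at
    most one nu. *)
Lemma card_bidegree (i j : int) : #|bidegree i j : pred (gen Gamma n)| =
  (\sum_nu \sum_(x | tag x == vstate nu)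
    ((weight nu)%:Z == i) && (gdeg (x : gen Gamma n) == j))%N.
Proof.
rewrite -sum1_card big_mkcond (exchange_big_dep predT) //=; apply: eq_bigr => x _.
rewrite unfold_in /bidegree; case: existsP => [[nu /andP[/eqP tx wi]]|nex] /=.
  rewrite (bigD1 nu) ?tx //= wi big1 ?addn0 //.
  by move=> nu' /andP[/eqP/(vstate_inj tri)->]; rewrite eqxx.
rewrite big1 // => nu tx; case: eqP => //= wi; case: nex; exists nu.
by rewrite tx wi eqxx.
Qed.

(** The exponents on the circles are chosen independently, so by distributivity the sum is a product
    of one factor [quantum_n n] per circle. *)
Lemma sum_gdeg (alpha : state G) :
  \sum_(x : gen Gamma n | tag x == alpha) var_q ^ gdeg x =
  var_q ^+ (m * weight alpha) * quantum_n n ^+ #|circles Gamma alpha|.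
Proof.
pose F (a : state G) (f : monomial Gamma n a) : laurent :=
  var_q ^ gdeg (Tagged (monomial Gamma n) f).
transitivity (\sum_(x : gen Gamma n | (tag x == alpha) && true) F (tag x) (tagged x)).
  by apply: eq_big => [x|[a f] _]; rewrite ?andbT.
rewrite -(sig_big_dep (fun a => a == alpha) (fun _ _ => true) F) /= big_pred1_eq.
have qz a b : var_q ^ (a + b) = var_q ^ a * var_q ^ b.
  by rewrite expfzDr // var_q_neq0.
rewrite /F /gdeg /=; under eq_bigr => f _ do
  rewrite qz (big_morph (fun z => var_q ^ z) qz (expr0z _)) mulrC.
rewrite -big_distrr /=; congr (_ * _).
have -> : #|circles Gamma alpha| = #|circle Gamma alpha| by rewrite card_sig.
have D := bigA_distr_bigA (R := laurent) (times := *%R) (plus := +%R)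
  (fun (_ : circle Gamma alpha) (e : 'I_n) => var_q ^ (m%:Z - e%:Z)).
transitivity (\prod_(c in circle Gamma alpha) quantum_n n); last by rewrite prodr_const.
exact: esym (D 1).
Qed.

Lemma vertex_poly_euler_char :
  vertex_poly Gamma n = euler_char dim (VCH Gamma n sqrtn ord hs).
Proof.
rewrite euler_char_VCH.
pose c (i j : int) : rat := #|bidegree i j : pred (gen Gamma n)|%:R.
have euler j : \sum_(i < N.+1) (-1) ^+ i * dim (VCH Gamma n sqrtn ord hs i j) =
    \sum_(i < N.+1) (-1) ^+ i * c i j.
  have dd w : delta sqrtn ord hs (delta sqrtn ord hs w) = 0 :> chain Gamma n k.
    exact: delta_delta.
  have dC i w : w \in homogeneous Gamma n k i j ->
    delta sqrtn ord hs w \in homogeneous Gamma n k (i + 1) j.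
    exact: delta_homogeneous.
  have C0 i w : w \in homogeneous Gamma n k i j -> (i < 0) || (N%:Z < i) -> w = 0.
    by move=> /homogeneous_trivial wt /orP[] iN; apply: wt; rewrite iN ?orbT.
  apply: etrans (@euler_char_complex k dim dimP _ _ dd (sub_fin_gen_chain _ _ _)
    (fun i => homogeneous Gamma n k i j) N dC C0) _.
  apply: eq_bigr => i _; congr (_ * _); exact: (dim_supported dimP).
have cstM a b : cst (a * b) = cst a * cst b by rewrite polyCM tofracM.
have cstS i : cst ((-1) ^+ i) = (-1) ^+ i by rewrite rmorphXn tofracXn /= rmorphN rmorph1 rmorphN1.
have cstD : {morph (fun r => cst r) : a b / a + b} by move=> a b; rewrite polyCD tofracD.
have cst0 : cst 0 = 0 by rewrite polyC0 tofrac0.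
have cstn b : cst (b%:R) = b%:R by rewrite !rmorph_nat.
have swap (h : int -> int -> rat) :
    \sum_(i < N.+1) (-1) ^+ i * \sum_(j <- degrees) var_q ^ j * cst (h i j) =
    \sum_(j <- degrees) var_q ^ j * cst (\sum_(i < N.+1) (-1) ^+ i * h i j).
  under eq_bigr => i _ do rewrite big_distrr /=.
  rewrite exchange_big; apply: eq_bigr => j _ /=.
  rewrite (big_morph (fun r => cst r) cstD cst0) big_distrr; apply: eq_bigr => i _ /=.
  by rewrite cstM cstS mulrCA.
rewrite (swap (fun i j => dim (VCH Gamma n sqrtn ord hs i j))); under eq_bigr => j _ do rewrite euler.
rewrite -(swap c) /c /vertex_poly.
(* An indicator of the bidegree of [x]: each generator is spread over all (i, j) with a single
   nonzero term, after which the sums can be exchanged. *)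
pose t (i j : int) (nu : {ffun vertex G -> bool}) (x : gen Gamma n) : laurent :=
  (((weight nu)%:Z == i) && (gdeg x == j))%:R.
transitivity (\sum_nu \sum_(x : gen Gamma n | tag x == vstate nu)
    \sum_(i < N.+1) \sum_(j <- degrees) (-1) ^+ i * (var_q ^ j * t i j nu x)).
  apply: eq_bigr => nu _.
  rewrite -mulrA -mulnA (mulnCA 3) -(weight_vstate tri) -sum_gdeg big_distrr.
  apply: eq_bigr => x _ /=.
  have wlt : (weight nu < N.+1)%N by rewrite ltnS weight_le.
  rewrite (bigD1 (Ordinal wlt)) //= [X in _ + X]big1 ?addr0 => [|i ine]; last first.
    rewrite big1 // => j _; rewrite /t (_ : (_ == _) = false) ?mulr0 //.
    by apply: contraNF ine => /eqP[e]; apply/eqP/val_inj.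
  have dx : gdeg x \in degrees by rewrite mem_undup; apply/mapP; exists x; rewrite ?mem_enum.
  rewrite (bigD1_seq (gdeg x)) ?undup_uniq //= big1 ?addr0 => [|j /negbTE jne].
    by rewrite /t !eqxx mulr1.
  by rewrite /t (eq_sym _ j) jne andbF !mulr0.
under eq_bigr => nu _ do rewrite exchange_big /=.
rewrite exchange_big; apply: eq_bigr => i _ /=.
under eq_bigr => nu _ do rewrite exchange_big /=.
rewrite exchange_big big_distrr; apply: eq_bigr => j _ /=.
under eq_bigr => nu _ do (rewrite -big_distrr -big_distrr /=).
rewrite -big_distrr -big_distrr /= cstn card_bidegree natr_sum.
by do 2!congr (_ * _); apply: eq_bigr => nu _; rewrite natr_sum.
Qed.

End EulerCharacteristic.

(** * The rank over a domain *)

Lemma extend_lift (T : Type) r (p : 'I_r.+1) (x : T) (f : 'I_r -> T) :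
  exists F : 'I_r.+1 -> T, F p = x /\ forall i, F (lift p i) = f i.
Proof.
exists (fun i => if unlift p i is Some j then f j else x).
by rewrite unlift_none; split=> // i; rewrite liftK.
Qed.

Lemma extend_split (T : Type) r r' (f : 'I_r -> T) (f' : 'I_r' -> T) :
  exists F : 'I_(r + r') -> T,
    (forall i, F (lshift r' i) = f i) /\ forall j, F (rshift r j) = f' j.
Proof.
exists (fun i => match fintype.split i with inl i => f i | inr j => f' j end).
by split=> i; [rewrite (unsplitK (inl i)) | rewrite (unsplitK (inr i))].
Qed.

Section Rank.
Variable k : comNzRingType.
Hypothesis domk : is_domain k.

(** Gaussian elimination without division, one column at a time; the domain hypothesis keeps
    multiples by the pivot nonzero. *)
Lemma nontrivial_relation d r (A : 'I_r -> 'I_d -> k) : (d < r)%N ->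
  exists2 l : 'I_r -> k, exists i, l i != 0 & forall j, \sum_i l i * A i j = 0.
Proof.
elim: d r A => [|d IHd] [//|r] A; rewrite ltnS => dr.
  exists (fun => 1); last by case.
  by exists ord0; apply: oner_neq0.
have [/existsP[p cp]|/existsPn A0] := boolP [exists p, A p ord0 != 0]; last first.
  have [l l0 lA] := IHd _ (fun i j => A i (lift ord0 j)) (leqW dr).
  exists l => // j; case: (unliftP ord0 j) => [j' ->|->]; first exact: lA.
  by rewrite big1 // => i _; rewrite (eqP (negbNE (A0 i))) mulr0.
set c := A p ord0 in cp.
(* Each row is multiplied by the pivot c before the first column is cleared. Back in the original
   rows, row p receives what was subtracted. *)
have [l [i0 li0] lA] := IHd _ (fun i j => c * A (lift p i) (lift ord0 j) -
  A (lift p i) ord0 * A p (lift ord0 j)) dr.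
have [l' [l'p l'E]] := extend_lift p (- \sum_i' l i' * A (lift p i') ord0)
  (fun i => c * l i).
exists l'.
  by exists (lift p i0); rewrite l'E; apply/eqP=> /domk[] /eqP; exact/negP.
move=> j; rewrite (bigD1_ord p) //= l'p.
under eq_bigr => i _ do rewrite l'E.
case: (unliftP ord0 j) => [j' ->|->].
  rewrite -[RHS](lA j') mulNr addrC big_distrl -sumrB /=.
  by apply: eq_bigr => i _; rewrite mulrBr !mulrA (mulrC c).
rewrite mulNr big_distrl addrC -sumrB big1 // => i _ /=.
by rewrite -/c; ring.
Qed.

Definition independent (M : lmodType k) r (e : 'I_r -> M) : Prop :=
  forall a : 'I_r -> k, \sum_i a i *: e i = 0 -> forall i, a i = 0.

(** Over a domain this is spanning after extension to the field of fractions, expressed inside M. *)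
Definition torsion_spanning (M : lmodType k) r (e : 'I_r -> M) : Prop :=
  forall x, exists2 a : k, a != 0 & exists c : 'I_r -> k, a *: x = \sum_i c i *: e i.

Lemma independent_le (M : lmodType k) d (e : 'I_d -> M) r :
  torsion_spanning e -> has_independent M r -> (r <= d)%N.
Proof.
move=> te [x xi]; rewrite leqNgt; apply/negP=> dr.
have /fin_all_exists[a] : forall i, exists a, a != 0 /\
    exists c : 'I_d -> k, a *: x i = \sum_i c i *: e i.
  by move=> i; have [a a0 ac] := te (x i); exists a.
move=> /all_and2[a0 /fin_all_exists[c ac]].
have [l [i li] lc] := nontrivial_relation c dr.
have /xi/(_ i)/domk[] : \sum_i (l i * a i) *: x i = 0; last 2 first.
- by apply/eqP.
- by apply/eqP.
under eq_bigr => j _ do rewrite -scalerA ac scaler_sumr.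
rewrite exchange_big big1 // => j _ /=.
under eq_bigr => j' _ do rewrite scalerA.
by rewrite -scaler_suml lc scale0r.
Qed.

Definition rank_bounded (M : lmodType k) : Prop :=
  exists d, forall r, has_independent M r -> (r <= d)%N.

Lemma sub_fin_gen_bounded (M : lmodType k) : sub_fin_gen M -> rank_bounded M.
Proof.
case=> N [f [d [g [fi gs]]]]; exists d => r [e ei].
apply: (@independent_le N d (fun i => g (delta_mx 0 i))).
  move=> x; exists 1; first exact: oner_neq0.
  have [y <-] := gs x; exists (y 0); rewrite scale1r.
  by rewrite {1}(row_sum_delta y) linear_sum; apply: eq_bigr => i _; rewrite linearZ.
exists (f \o e) => a; rewrite /= => ae; apply: ei; apply: fi.
by rewrite linear0 linear_sum -[RHS]ae; apply: eq_bigr => i _; rewrite linearZ.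
Qed.

Lemma rankP (M : lmodType k) : rank_bounded M ->
  has_independent M (rank M) /\ forall r, has_independent M r -> (r <= rank M)%N.
Proof.
case=> d dP; suff : exists r, has_independent M r /\
    forall r', has_independent M r' -> (r' <= r)%N.
  by move/(@classical_sets.xgetPex _ 0%N).
have ex0 : exists r, `[< has_independent M r >].
  by exists 0%N; apply/asboolP; exists (fun=> 0) => a _ [].
have bd r : `[< has_independent M r >] -> (r <= d)%N by move/asboolP/dP.
case: (ex_maxnP ex0 bd) => r /asboolP rP rmax; exists r; split=> // r' r'P.
by apply: rmax; apply/asboolP.
Qed.

(** An independent family of maximal length becomes dependent when any x is added, and a relation
    that shows this multiplies x by a nonzero scalar. *)
Lemma rank_basis (M : lmodType k) : rank_bounded M ->
  exists e : 'I_(rank M) -> M, independent e /\ torsion_spanning e.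
Proof.
move=> /rankP[[e ei] emax]; exists e; split=> // x.
have [e1 [e1x e1E]] := extend_lift ord0 x e.
have : ~ independent e1 by move=> ie; have := emax _ (ex_intro _ e1 ie); rewrite ltnn.
move=> /existsNP[a /not_implyP[]]; rewrite big_ord_recl e1x.
under eq_bigr => i _ do rewrite e1E.
move=> ae nz; have ax : a ord0 *: x = \sum_i (- a (lift ord0 i)) *: e i.
  by under eq_bigr => i _ do rewrite scaleNr; rewrite sumrN; apply/eqP; rewrite -addr_eq0 ae.
exists (a ord0); last by exists (fun i => - a (lift ord0 i)).
apply: contra_notN nz => /eqP a0 i; case: (unliftP ord0 i) => [j ->|-> //].
move: ae; rewrite a0 scale0r add0r => ae.
exact: (ei (fun i => a (lift ord0 i)) ae j).
Qed.

Lemma rank_eq (M : lmodType k) r (e : 'I_r -> M) :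
  independent e -> torsion_spanning e -> rank M = r.
Proof.
move=> ei te; have bd : rank_bounded M by exists r => r'; apply: independent_le te.
have [ri rmax] := rankP bd; apply/eqP; rewrite eqn_leq (independent_le te ri).
by apply: rmax; exists e.
Qed.

(** The image of a maximal family of M', followed by lifts of one of M'', is independent and torsion
    spanning in M. *)
Lemma rank_dimension_function :
  dimension_function (fun M : lmodType k => (rank M)%:R : rat).
Proof.
split.
  rewrite (@rank_eq k^o 1 (fun=> 1)) // => [a|x].
    by rewrite big_ord1 => a0 i; rewrite ord1 -[LHS]mulr1.
  exists 1; first exact: oner_neq0.
  by exists (fun=> x); rewrite big_ord1 scale1r -[LHS]mulr1.
move=> M' M M'' f g fg fi exact_fg gs; rewrite -natrD; congr _%:R.
have [e' [ie' te']] := rank_basis (sub_fin_gen_bounded (sub_fin_gen_inj fi fg)).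
have [d dP] := sub_fin_gen_bounded fg.
have lift r (e : 'I_r -> M'') : exists l : 'I_r -> M, forall i, g (l i) = e i.
  have ge i : exists x, g x = e i by apply: gs.
  exact: fin_all_exists ge.
have bd'' : rank_bounded M''.
  exists d => r [e ei]; apply: dP; have [l le] := lift _ e; exists l => a al; apply: (ei a).
  have := congr1 g al; rewrite linear_sum linear0 => gal.
  by rewrite -[RHS]gal; apply: eq_bigr => i _; rewrite linearZ /= le.
have [e'' [ie'' te'']] := rank_basis bd''.
have [l le] := lift _ e''.
have [F [Fl Fr]] := extend_split (fun i => f (e' i)) l.
apply: (@rank_eq _ _ F).
  move=> a; rewrite big_split_ord /=.
  under eq_bigr => i _ do rewrite Fl.
  under [X in _ + X]eq_bigr => i _ do rewrite Fr.
  (* Applying g kills the part from M' and leaves a relation in M''. *)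
  move=> ae; have a'' : forall j, a (rshift _ j) = 0.
    apply: (ie'' (fun j => a (rshift _ j))); have /(congr1 g) := ae; rewrite linearD linear0 !linear_sum.
    rewrite big1 ?add0r => [ga|i _]; last first.
      have g0 : g (f (e' i)) = 0 by apply/exact_fg; exists (e' i).
      by rewrite linearZ /= g0 scaler0.
    by rewrite -[RHS]ga; apply: eq_bigr => j _; rewrite linearZ /= le.
  have a' : forall i, a (lshift _ i) = 0.
    apply: (ie' (fun i => a (lshift _ i))); apply: fi; rewrite linear0 linear_sum -[RHS]ae.
    rewrite [X in _ + X]big1 ?addr0 => [|j _]; last by rewrite a'' scale0r.
    by apply: eq_bigr => i _; rewrite linearZ.
  by move=> i; case: (splitP i) => j ij; [rewrite -(a' j)|rewrite -(a'' j)];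
    congr a; apply: val_inj.
move=> x; have [a a0 [c gc]] := te'' (g x).
have /exact_fg[y fy] : g (a *: x - \sum_j c j *: l j) = 0.
  rewrite linearB linearZ /= gc linear_sum; apply/eqP; rewrite subr_eq0; apply/eqP.
  by apply: eq_bigr => j _; rewrite linearZ /= le.
have [b b0 [c' yc]] := te' y.
(* The scalar a brings x into the span of the lifts up to an element f y, and b then brings y into
   the span of [e']. *)
exists (b * a); first by apply/eqP=> /domk[] /eqP; apply/negP.
have [C [Cl Cr]] := extend_split c' (fun j => b * c j).
exists C; rewrite big_split_ord /=.
under eq_bigr => i _ do rewrite Fl Cl.
under [X in _ + X]eq_bigr => i _ do rewrite Fr Cr -scalerA.
rewrite -scaler_sumr -scalerA -[a *: x](subrK (\sum_j c j *: l j)) -fy scalerDr.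
rewrite -[b *: f y]linearZ /= yc linear_sum; congr (_ + _).
by apply: eq_bigr => i _; rewrite linearZ.
Qed.

End Rank.

(** * Equivalent ribbon graphs *)

Section HomologyMap.
Variables (k : comNzRingType) (W1 W2 : lmodType k).
Variables (d1 : {linear W1 -> W1}) (d2 : {linear W2 -> W2}).
Variables (C1' C1 : submodClosed W1) (C2' C2 : submodClosed W2).

Definition homology_class (W : lmodType k) (d : {linear W -> W})
    (C' C : submodClosed W) : {linear cycle_lmod d C -> homology d C' C} :=
  @quot_proj k (cycle_lmod d C) (boundary_submod d C' C).

(** The map is characterized by any cycle [z2] with the right value, so that its use does not refer
    to the membership proof chosen inside. *)
Lemma homology_map (phi : {linear W1 -> W2}) :
  (forall w, phi (d1 w) = d2 (phi w)) ->
  (forall w, w \in C1 -> phi w \in C2) -> (forall w, w \in C1' -> phi w \in C2') ->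
  exists f : {linear homology d1 C1' C1 -> homology d2 C2' C2},
    forall (z1 : cycle_lmod d1 C1) (z2 : cycle_lmod d2 C2), val z2 = phi (val z1) ->
      f (homology_class d1 C1' C1 z1) = homology_class d2 C2' C2 z2.
Proof.
move=> pd pC pC'.
have pZ (z : cycle_lmod d1 C1) : is_cycle d2 C2 (phi (val z)).
  by case/andP: (valP z) => Cz /eqP dz; rewrite /is_cycle pC // -pd dz linear0 eqxx.
pose p z : cycle_lmod d2 C2 := exist _ (phi (val z)) (pZ z).
have pD a u v : p (a *: u + v) = a *: p u + p v by apply: val_inj; rewrite /= !linearP.
have pB u v : homology_class d1 C1' C1 u = homology_class d1 C1' C1 v ->
    homology_class d2 C2' C2 (p u) = homology_class d2 C2' C2 (p v).
  move=> uv; apply/eqP; rewrite -subr_eq0 -linearB; apply/eqP/quot_proj_eq0.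
  have /quot_proj_eq0/asboolP[w Cw dw] : homology_class d1 C1' C1 (u - v) = 0.
    by rewrite linearB uv subrr.
  by apply/asboolP; exists (phi w); [exact: pC' | rewrite -pd dw /= linearB].
pose f (y : homology d1 C1' C1) : homology d2 C2' C2 :=
  homology_class d2 C2' C2 (p (repr y)).
have fE z : f (homology_class d1 C1' C1 z) = homology_class d2 C2' C2 (p z).
  by apply: pB; rewrite /homology_class /= /quot_proj reprK.
have f_lin : linear f.
  move=> a x y; have [u <-] := quot_proj_surj x; have [v <-] := quot_proj_surj y.
  rewrite -[quot_proj _ u]/(homology_class d1 C1' C1 u).
  rewrite -[quot_proj _ v]/(homology_class d1 C1' C1 v) -linearP !fE pD.
  exact: linearP.
pose fL : {linear homology d1 C1' C1 -> homology d2 C2' C2} :=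
  HB.pack f (GRing.isLinear.Build k _ _ *:%R f f_lin).
exists fL => z1 z2 zE.
by rewrite [LHS]fE; congr (homology_class _ _ _ _); apply: val_inj.
Qed.
End HomologyMap.

Lemma homology_iso (k : comNzRingType) (W1 W2 : lmodType k)
    (d1 : {linear W1 -> W1}) (d2 : {linear W2 -> W2})
    (C1' C1 : submodClosed W1) (C2' C2 : submodClosed W2)
    (phi : {linear W1 -> W2}) (psi : {linear W2 -> W1}) :
  cancel phi psi -> cancel psi phi -> (forall w, phi (d1 w) = d2 (phi w)) ->
  (forall w, (phi w \in C2) = (w \in C1)) -> (forall w, (phi w \in C2') = (w \in C1')) ->
  lmod_iso (homology d1 C1' C1) (homology d2 C2' C2).
Proof.
move=> phiK psiK pd pC pC'.
have [||f fE] := @homology_map _ _ _ d1 d2 C1' C1 C2' C2 phi pd;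
  try by move=> w; rewrite ?pC ?pC'.
have qd w : psi (d2 w) = d1 (psi w) by rewrite -{1}[w]psiK -pd phiK.
have [||g gE] := @homology_map _ _ _ d2 d1 C2' C2 C1' C1 psi qd;
  try by move=> w; rewrite -?pC -?pC' psiK.
have pZ (z : cycle_lmod d1 C1) : is_cycle d2 C2 (phi (val z)).
  by case/andP: (valP z) => Cz /eqP dz; rewrite /is_cycle pC Cz -pd dz linear0 eqxx.
have qZ (z : cycle_lmod d2 C2) : is_cycle d1 C1 (psi (val z)).
  case/andP: (valP z) => Cz /eqP dz.
  by rewrite /is_cycle -pC psiK Cz -qd dz linear0 eqxx.
pose p z : cycle_lmod d2 C2 := exist _ (phi (val z)) (pZ z).
pose q z : cycle_lmod d1 C1 := exist _ (psi (val z)) (qZ z).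
exists f; exists g => y; have [z <-] := quot_proj_surj y.
  by rewrite [f _](fE z (p z)) // [LHS](gE _ z) //= phiK.
by rewrite [g _](gE z (q z)) // [LHS](fE _ z) //= psiK.
Qed.

Lemma connect_map (T T' : finType) (e : rel T) (e' : rel T') (f : T -> T') :
  (forall x y, e x y -> e' (f x) (f y)) ->
  forall x y, connect e x y -> connect e' (f x) (f y).
Proof.
move=> fe x y /connectP[p]; elim: p x => [|z p IHp] x /=; first by move=> _ ->.
by case/andP=> xz zp yE; apply: connect_trans (connect1 (fe _ _ xz)) (IHp z zp yE).
Qed.

Section RibbonEquivalence.
Variables (G1 G2 : multigraph) (Gamma1 : ribbon G1) (Gamma2 : ribbon G2).
Variables (fV : vertex G1 -> vertex G2) (gV : vertex G2 -> vertex G1).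
Variables (fH : half_edge G1 -> half_edge G2) (gH : half_edge G2 -> half_edge G1).
Variable fC : circle_edge G1 -> circle_edge G2.
Variables (fS : side G1 -> side G2) (gS : side G2 -> side G1).
Hypotheses (fVK : cancel fV gV) (gVK : cancel gV fV).
Hypotheses (fHK : cancel fH gH) (gHK : cancel gH fH).
Hypotheses (fSK : cancel fS gS) (gSK : cancel gS fS).
Hypothesis vert_fH : forall h, vert (fH h) = fV (vert h).
Hypothesis opp_fH : forall h, opp (fH h) = fH (opp h).
Hypothesis fS1 : forall x, (fS x).1 =
  match x.1 with inl h => inl (fH h) | inr c => inr (fC c) end.
Hypothesis fS_corner : forall x, fS (corner Gamma1 x) = corner Gamma2 (fS x).
Hypothesis fS_band0 : forall x,
  fS (band Gamma1 (state0 G1) x) = band Gamma2 (state0 G2) (fS x).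

Definition state_map (alpha : state G1) : state G2 := [ffun h => alpha (gH h)].
Definition state_inv (alpha : state G2) : state G1 := [ffun h => alpha (fH h)].

Lemma state_mapK : cancel state_map state_inv.
Proof. by move=> alpha; apply/ffunP=> h; rewrite !ffunE fHK. Qed.

Lemma state_invK : cancel state_inv state_map.
Proof. by move=> alpha; apply/ffunP=> h; rewrite !ffunE gHK. Qed.

Lemma state_map_raise alpha h : state_map (raise alpha h) = raise (state_map alpha) (fH h).
Proof. by apply/ffunP=> h'; rewrite !ffunE (can2_eq gHK fHK). Qed.

(** [fS] may exchange left and right, but being injective and compatible with [fH] and [fC] it sends
    opposite sides to opposite sides. *)
Lemma fS_flip x : fS (x.1, ~~ x.2) = ((fS x).1, ~~ (fS x).2).
Proof.
have e1 : (fS (x.1, ~~ x.2)).1 = (fS x).1 by rewrite !fS1.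
have : fS (x.1, ~~ x.2) != fS x.
  by rewrite (can_eq fSK); case: (x) => x1 [] /=; rewrite xpair_eqE eqxx.
move: (fS (x.1, ~~ x.2)) (fS x) e1 => [a b] [a' b'] /= ->.
by rewrite xpair_eqE eqxx /=; case: b; case: b'.
Qed.

Lemma band_state0 (G : multigraph) (Gamma : ribbon G) alpha x : band Gamma alpha x =
  let y := band Gamma (state0 G) x in
  if x.1 is inl h then (y.1, y.2 (+) (alpha h (+) alpha (opp h))) else y.
Proof.
case: x => -[h|c] b //=; congr (_, _); rewrite /twisted !ffunE !addbF.
by case: b; case: neg; case: (alpha h); case: (alpha _).
Qed.

(** Compatibility is assumed for the state 0 only. Other states differ from it by flips of sides,
    which [fS] respects. *)
Lemma fS_band alpha x :
  fS (band Gamma1 alpha x) = band Gamma2 (state_map alpha) (fS x).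
Proof.
rewrite [in LHS]band_state0 [in RHS]band_state0 fS1 -fS_band0 /=.
case: x => -[h|c] b //=; rewrite !ffunE opp_fH !fHK.
case: (alpha h (+) alpha (opp h)); rewrite ?addbF ?addbT -?surjective_pairing //.
exact: (fS_flip (inl (opp h), _)).
Qed.

Lemma same_circle_fS alpha s t :
  same_circle Gamma2 (state_map alpha) (fS s) (fS t) = same_circle Gamma1 alpha s t.
Proof.
have arcE u v : arc Gamma2 (state_map alpha) (fS u) (fS v) = arc Gamma1 alpha u v.
  by rewrite /arc -fS_corner -fS_band !(can_eq fSK).
apply/idP/idP; last by apply: connect_map => u v; rewrite arcE.
rewrite -{2}[s]fSK -{2}[t]fSK; apply: connect_map => u v.
by rewrite -{1}[u]gSK -{1}[v]gSK arcE.
Qed.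

Lemma fS_half h b : exists b', fS (inl h, b) = (inl (fH h), b').
Proof. by exists (fS (inl h, b)).2; rewrite [LHS]surjective_pairing fS1. Qed.

Lemma fS_sides h :
  fS (inl h, true) = (inl (fH h), true) /\ fS (inl h, false) = (inl (fH h), false) \/
  fS (inl h, true) = (inl (fH h), false) /\ fS (inl h, false) = (inl (fH h), true).
Proof.
have [b e] := fS_half h true; have := fS_flip (inl h, true); rewrite e /= => e'.
by case: b e e' => e e'; [left | right].
Qed.

Lemma joined_fH alpha h : joined Gamma2 (state_map alpha) (fH h) = joined Gamma1 alpha h.
Proof.
rewrite /joined -same_circle_fS; have [[-> ->]//|[-> ->]] := fS_sides h.
exact: same_circle_sym.
Qed.

Lemma touched_fH alpha h s :
  touched Gamma2 (state_map alpha) (fH h) (fS s) = touched Gamma1 alpha h s.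
Proof.
rewrite /touched -!(same_circle_fS _ _ s); have [[-> ->]//|[-> ->]] := fS_sides h.
exact: orbC.
Qed.

Variables (n : nat) (k : comNzRingType) (sqrtn : k).
Hypothesis n_gt0 : (0 < n)%N.
Local Notation m := (half_color n).

Definition gen_map (x : gen Gamma1 n) : gen Gamma2 n :=
  gen_of Gamma2 n_gt0 (state_map (tag x)) (fun s => exponent x (gS s)).

Definition gen_inv (y : gen Gamma2 n) : gen Gamma1 n :=
  gen_of Gamma1 n_gt0 (state_inv (tag y)) (fun s => exponent y (fS s)).

Lemma exponent_gen_map x s : exponent (gen_map x) (fS s) = exponent x s.
Proof.
rewrite exponent_gen_of ?fSK // => [u v uv|u]; last exact: exponent_lt.
by apply: exponent_same; rewrite -same_circle_fS !gSK.
Qed.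

Lemma exponent_gen_inv y s : exponent (gen_inv y) s = exponent y (fS s).
Proof.
rewrite exponent_gen_of // => [u v uv|u]; last exact: exponent_lt.
by apply: exponent_same; rewrite -[tag y]state_invK same_circle_fS.
Qed.

Lemma gen_mapK : cancel gen_map gen_inv.
Proof.
move=> x; apply: gen_eq => [|s]; first exact: state_mapK.
by rewrite exponent_gen_inv exponent_gen_map.
Qed.

Lemma gen_invK : cancel gen_inv gen_map.
Proof.
move=> y; apply: gen_eq => [|s]; first exact: state_invK.
by rewrite -[s]gSK exponent_gen_map exponent_gen_inv.
Qed.

Lemma total_fH h x : total (fH h) (gen_map x) = total h x.
Proof.
rewrite /total [tag (gen_map x)]/= joined_fH -!exponent_gen_map.
have [[-> ->]//|[le re]] := fS_sides h; case: ifP => j; last by rewrite le re addnC.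
have e := exponent_same j; rewrite -!exponent_gen_map in e.
by rewrite e re.
Qed.

Lemma edge_coef_fH h x y :
  edge_coef sqrtn (fH h) (gen_map x) (gen_map y) = edge_coef sqrtn h x y.
Proof.
rewrite !edge_coefE /step_type !total_fH [tag (gen_map x)]/= [tag (gen_map y)]/= !joined_fH.
rewrite -state_map_raise (can_eq state_mapK) ffunE fHK.
have [x0|//] := boolP (~~ tag x h); have [ty|//] := eqVneq (tag y) _.
have tog : toggled Gamma1 h (tag x) (tag y) by rewrite ty; apply: raise_toggled.
have tog2 : toggled Gamma2 (fH h) (tag (gen_map x)) (tag (gen_map y)).
  by rewrite /= ty state_map_raise; apply: raise_toggled; rewrite ffunE fHK.
congr (if _ then _ else _); rewrite !andTb; apply/(same_offP tog2)/(same_offP tog).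
  move=> so s un; rewrite -!exponent_gen_map; apply: so.
  by rewrite [tag _]/= touched_fH.
move=> so s; rewrite -[s]gSK [tag _]/= touched_fH !exponent_gen_map; exact: so.
Qed.

Lemma gdeg_gen_map x : gdeg (gen_map x) = gdeg x.
Proof.
rewrite /gdeg; congr (_ + _).
  pose p (c : circle Gamma1 (tag x)) := circle_of Gamma2 (state_map (tag x)) (fS (circle_rep c)).
  pose q (c : circle Gamma2 (state_map (tag x))) := circle_of Gamma1 (tag x) (gS (circle_rep c)).
  have pK : cancel p q.
    move=> c; rewrite -[RHS]circle_repK; apply/eqP; rewrite circle_of_eq.
    by rewrite -same_circle_fS gSK same_circle_rep.
  have qK : cancel q p.
    move=> c; rewrite -[RHS]circle_repK; apply/eqP; rewrite circle_of_eq.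
    by rewrite -[X in same_circle _ _ _ X]gSK same_circle_fS same_circle_rep.
  rewrite (reindex p); last by exists q => c _.
  apply: eq_bigr => c _; congr (_ - _%:Z).
  rewrite -[in RHS](circle_repK c); exact: exponent_gen_map.
congr (_ * _)%N%:Z; rewrite /weight (reindex fH) /=.
  by apply: eq_bigr => h _; rewrite ffunE fHK.
by exists gH => h _.
Qed.


Hypothesis sqrtn2 : sqrtn ^+ 2 = n%:R.
Hypothesis tri : trivalent G1.
Variables (ord1 : vertex G1 -> 'I_#|vertex G1|) (ord2 : vertex G2 -> 'I_#|vertex G2|).
Variables (hs1 : vertex G1 -> seq (half_edge G1)) (hs2 : vertex G2 -> seq (half_edge G2)).
Hypotheses (ord1_inj : vertex_order ord1) (ord2_inj : vertex_order ord2).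
Hypotheses (hs1P : path_choice hs1) (hs2P : path_choice hs2).
Implicit Types (w : chain Gamma1 n k) (nu : {ffun vertex G1 -> bool}).

Definition transport w : chain Gamma2 n k := [ffun y => w (gen_inv y)].

Lemma transport_linear : linear transport.
Proof. by move=> a u v; apply/ffunP=> y; rewrite !ffunE. Qed.
HB.instance Definition _ := GRing.isLinear.Build k (chain Gamma1 n k) (chain Gamma2 n k)
  *:%R transport transport_linear.

Lemma transport_edge_map h w :
  transport (edge_map sqrtn h w) = edge_map sqrtn (fH h) (transport w).
Proof.
apply/ffunP=> y; rewrite !ffunE (reindex gen_inv) /=; last first.
  by exists gen_map => x _; [apply: gen_invK | apply: gen_mapK].
apply: eq_bigr => x _; rewrite ffunE -[in RHS](gen_invK x) -[in RHS](gen_invK y).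
by rewrite edge_coef_fH gen_mapK.
Qed.

Lemma transport_compose p w :
  transport (compose_path sqrtn p w) = compose_path sqrtn (map fH p) (transport w).
Proof.
elim: p w => //= h p IHp w; rewrite /compose_path /= -!/(compose_path sqrtn _ _).
by rewrite IHp transport_edge_map.
Qed.

Lemma transport_proj alpha w :
  transport (proj_state alpha w) = proj_state (state_map alpha) (transport w).
Proof.
apply/ffunP=> y; rewrite !ffunE /=; congr (if _ then _ else _).
exact: (can2_eq state_invK state_mapK).
Qed.

Definition vstate_map nu : {ffun vertex G2 -> bool} := [ffun v => nu (gV v)].

Lemma vstate_mapE nu : vstate (vstate_map nu) = state_map (vstate nu).
Proof.
by apply/ffunP=> h; rewrite !ffunE -{1}[h]gHK vert_fH fVK.
Qed.

Lemma weight_vstate_map nu : weight (vstate_map nu) = weight nu.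
Proof.
rewrite /weight (reindex fV) /=; last by exists gV => v _.
by apply: eq_bigr => v _; rewrite ffunE fVK.
Qed.

(** * Signs for a change of the order of the vertices *)

Definition inverted u v := (ord1 u < ord1 v)%N && (ord2 (fV v) < ord2 (fV u))%N.

Definition inversions nu : nat :=
  (\sum_u \sum_v inverted u v * (nu u * nu v))%N.

Lemma before_vstate_map nu v :
  before ord2 (vstate_map nu) (fV v) = (\sum_(u | (ord2 (fV u) < ord2 (fV v))%N) nu u)%N.
Proof.
rewrite /before (reindex fV) /=; last by exists gV => u _.
by apply: eq_bigr => u _; rewrite ffunE fVK.
Qed.

(* Raising v creates an inversion with each u of nu on which the two orders
   disagree; every other u is either before v in both orders or in none. *)
Lemma inversions_vraise nu v : ~~ nu v -> exists c,
  (inversions (vraise nu v) + c.*2 =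
   inversions nu + (before ord1 nu v + before ord2 (vstate_map nu) (fV v)))%N.
Proof.
move=> nv.
(* The vertices of nu before v in both orders: they are counted twice on the right and create no
   inversion. *)
exists (\sum_u ((ord1 u < ord1 v) && (ord2 (fV u) < ord2 (fV v))) * nu u)%N.
have vr u : vraise nu v u = (nu u + (u == v))%N :> nat.
  by rewrite ffunE; case: eqVneq => [->|_] /=; rewrite ?(negbTE nv) ?addn0.
have -> : inversions (vraise nu v) = (inversions nu +
    ((\sum_u inverted u v * nu u) + (\sum_u inverted v u * nu u)))%N.
  rewrite /inversions.
  transitivity (\sum_u (\sum_w inverted u w * (nu u * nu w) +
     (inverted u v * nu u + (u == v) * \sum_w inverted v w * nu w)))%N.
    apply: eq_bigr => u _; have -> : (inverted u v * nu u)%N =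
        (\sum_w (w == v) * (inverted u v * nu u))%N.
      by rewrite (bigD1 v) //= eqxx mul1n big1 ?addn0 // => w /negbTE->.
    rewrite big_distrr -!big_split; apply: eq_bigr => w _ /=; rewrite !vr.
    case: (eqVneq u v) => [->|_]; case: (eqVneq w v) => [->|_] //=.
    - by rewrite /inverted ltnn (negbTE nv).
    - by rewrite (negbTE nv); lia.
    - by rewrite (negbTE nv); lia.
    - by lia.
  rewrite !big_split /=; congr (_ + (_ + _))%N.
  by rewrite (bigD1 v) //= eqxx mul1n [X in (_ + X)%N]big1 ?addn0 // => u /negbTE->.
have condM (P : pred (vertex G1)) : (\sum_(u | P u) nu u = \sum_u P u * nu u)%N.
  by rewrite big_mkcond; apply: eq_bigr => u _; case: (P u); rewrite ?mul1n.
rewrite before_vstate_map /before !condM -addnA; congr (_ + _)%N.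
rewrite -mul2n big_distrr -!big_split /=.
apply: eq_bigr => u _; rewrite /inverted; case: (eqVneq u v) => [->|uv].
  by rewrite (negbTE nv) !ltnn.
have : ord1 u != ord1 v :> nat by apply: contra uv => /eqP/val_inj/ord1_inj->.
have : ord2 (fV u) != ord2 (fV v) :> nat.
  by apply: contra uv => /eqP/val_inj/ord2_inj/(can_inj fVK)->.
move=> n2 n1; case: (ltngtP (ord1 u) (ord1 v)) n1 => // _ _;
  by case: (ltngtP (ord2 (fV u)) (ord2 (fV v))) n2 => // _ _; case: (nu u).
Qed.

(** A left inverse of [vstate], defined on all states so that the sign makes sense on every summand
    A_alpha. *)
Definition state_support (alpha : state G1) : {ffun vertex G1 -> bool} :=
  [ffun v => [exists h, (vert h == v) && alpha h]].

Lemma state_supportK nu : state_support (vstate nu) = nu.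
Proof.
apply/ffunP=> v; rewrite ffunE; apply/existsP/idP=> [[h /andP[/eqP <-]]|nv].
  by rewrite ffunE.
by have [h hv] := star_inhabited tri v; exists h; rewrite ffunE hv eqxx.
Qed.

Definition sign (alpha : state G1) : k := (-1) ^+ inversions (state_support alpha).

Definition signed w : chain Gamma1 n k := [ffun x => sign (tag x) * w x : k].

Lemma signed_linear : linear signed.
Proof. by move=> a u v; apply/ffunP=> x; rewrite !ffunE mulrDr [in LHS]mulrCA. Qed.
HB.instance Definition _ := GRing.isLinear.Build k (chain Gamma1 n k) (chain Gamma1 n k)
  *:%R signed signed_linear.

Lemma signedK : involutive signed.
Proof. by move=> w; apply/ffunP=> x; rewrite !ffunE mulrA -expr2 sqrr_sign mul1r. Qed.

Lemma signed_in_state alpha w : in_state alpha w -> signed w = sign alpha *: w.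
Proof.
move=> wa; apply/ffunP=> x; rewrite !ffunE.
by have [->//|/wa->] := eqVneq (tag x) alpha; rewrite !mulr0 scaler0.
Qed.

Lemma proj_signed alpha w : proj_state alpha (signed w) = sign alpha *: proj_state alpha w.
Proof.
apply/ffunP=> x; rewrite !ffunE; case: eqP => [->//|_]; by rewrite scaler0.
Qed.

Definition chain_iso w := transport (signed w).

Lemma compose_pathZ (G : multigraph) (Gamma : ribbon G) p a (w : chain Gamma n k) :
  compose_path sqrtn p (a *: w) = a *: compose_path sqrtn p w.
Proof.
by elim: p w => //= h p IHp w; rewrite /compose_path /= -!/(compose_path sqrtn _ _) linearZ IHp.
Qed.

Lemma chain_iso_delta w :
  chain_iso (delta sqrtn ord1 hs1 w) = delta sqrtn ord2 hs2 (chain_iso w).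
Proof.
rewrite /chain_iso [X in signed X]/delta [in RHS]/delta !linear_sum.
rewrite [RHS](reindex vstate_map) /=; last first.
  exists (fun nu2 : {ffun vertex G2 -> bool} => [ffun v => nu2 (fV v)]) => mu _; apply/ffunP=> v.
    by rewrite !ffunE fVK.
  by rewrite !ffunE gVK.
apply: eq_bigr => nu _; rewrite !linear_sum [RHS](reindex fV) /=; last by exists gV => v _.
apply: eq_big => [v|v nv]; first by rewrite ffunE fVK.
have st : in_state (vstate (vraise nu v))
    (compose_path sqrtn (hs1 v) (proj_state (vstate nu) w)).
  by apply: in_state_vertex; last exact: in_state_proj.
rewrite !linearZ /= (signed_in_state st).
rewrite vstate_mapE -transport_proj proj_signed !linearZ /= compose_pathZ transport_compose.
rewrite !scalerA /sign !state_supportK -!exprD.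
have [c cE] := inversions_vraise nv.
have even_sign a b : (-1) ^+ (a + b.*2) = (-1) ^+ a :> k.
  by rewrite exprD -mul2n exprM sqrrN !expr1n mulr1.
have -> : (-1) ^+ (inversions (vraise nu v) + before ord1 nu v) =
    (-1) ^+ (before ord2 (vstate_map nu) (fV v) + inversions nu) :> k.
  (* Adding 2c on the left and twice [before ord1 nu v] on the right turns the congruence modulo 2
     into the equality [cE]. *)
  rewrite -(even_sign _ c) -[RHS](even_sign _ (before ord1 nu v)); congr (_ ^+ _); lia.
(* The image of the path at v and the path at [fV v] run through the same star, possibly in
   different orders. *)
congr (_ *: _); apply: compose_path_perm => //; rewrite perm_sym.
apply: uniq_perm.
- by rewrite (perm_uniq (hs2P _)) enum_uniq.
- by rewrite (map_inj_uniq (can_inj fHK)) (perm_uniq (hs1P _)) enum_uniq.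
move=> h; rewrite (perm_mem (hs2P _)) -[h]gHK (mem_map (can_inj fHK)) (perm_mem (hs1P _)).
by rewrite !mem_enum !inE vert_fH (can_eq fVK).
Qed.


Lemma chain_iso_linear : linear chain_iso.
Proof. by move=> a u v; rewrite /chain_iso !linearP. Qed.
HB.instance Definition _ := GRing.isLinear.Build k (chain Gamma1 n k) (chain Gamma2 n k)
  *:%R chain_iso chain_iso_linear.

Definition transport_inv (w : chain Gamma2 n k) : chain Gamma1 n k :=
  [ffun x => w (gen_map x)].

Definition chain_iso_inv (w : chain Gamma2 n k) := signed (transport_inv w).

Lemma chain_iso_inv_linear : linear chain_iso_inv.
Proof.
move=> a u v; rewrite /chain_iso_inv -linearP; congr signed.
by apply/ffunP=> x; rewrite !ffunE.
Qed.
HB.instance Definition _ := GRing.isLinear.Build k (chain Gamma2 n k) (chain Gamma1 n k)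
  *:%R chain_iso_inv chain_iso_inv_linear.

Lemma chain_isoK : cancel chain_iso chain_iso_inv.
Proof.
move=> w; rewrite -[RHS]signedK; congr signed; apply/ffunP=> x.
by rewrite !ffunE gen_mapK.
Qed.

Lemma chain_iso_invK : cancel chain_iso_inv chain_iso.
Proof.
by move=> w; rewrite /chain_iso signedK; apply/ffunP=> y; rewrite !ffunE gen_invK.
Qed.

Lemma bidegree_gen_map i j x : bidegree i j (gen_map x) = bidegree i j x.
Proof.
rewrite /bidegree gdeg_gen_map; congr (_ && _); apply/existsP/existsP=> -[nu].
  case/andP=> /eqP tx wi; exists [ffun v => nu (fV v)].
  have nuE : vstate_map [ffun v => nu (fV v)] = nu by apply/ffunP=> v; rewrite !ffunE gVK.
  rewrite -weight_vstate_map nuE wi andbT; apply/eqP/(can_inj state_mapK).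
  by rewrite -vstate_mapE nuE.
case/andP=> /eqP tx wi; exists (vstate_map nu).
by rewrite weight_vstate_map wi vstate_mapE -tx eqxx.
Qed.

Lemma chain_iso_homogeneous i j w :
  (chain_iso w \in homogeneous Gamma2 n k i j) = (w \in homogeneous Gamma1 n k i j).
Proof.
have sgn0 alpha (a : k) : sign alpha * a = 0 -> a = 0.
  by move=> sa; rewrite -[a]mul1r -(sqrr_sign k (inversions (state_support alpha)))
    expr2 -mulrA [_ * a]sa mulr0.
apply/supportedP/supportedP=> [H x xP|H y yP].
  have := H (gen_map x); rewrite bidegree_gen_map => /(_ xP).
  by rewrite !ffunE gen_mapK => /sgn0.
rewrite !ffunE H ?mulr0 //; by rewrite -bidegree_gen_map gen_invK.
Qed.

Lemma VCH_iso i j : lmod_iso (VCH Gamma1 n sqrtn ord1 hs1 i j)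
                             (VCH Gamma2 n sqrtn ord2 hs2 i j).
Proof.
apply: (homology_iso chain_isoK chain_iso_invK chain_iso_delta);
  exact: chain_iso_homogeneous.
Qed.

End RibbonEquivalence.

Theorem theoremA (G : multigraph) (Gamma : ribbon G) (n : nat)
    (k : comNzRingType) (sqrtn : k) :
  trivalent G -> connected G -> (0 < n)%N -> sqrtn ^+ 2 = n%:R ->
  (forall (G' : multigraph) (Gamma' : ribbon G')
      (ord : vertex G -> 'I_#|vertex G|) (ord' : vertex G' -> 'I_#|vertex G'|)
      (hs : vertex G -> seq (half_edge G)) (hs' : vertex G' -> seq (half_edge G')),
    ribbon_equiv Gamma Gamma' ->
    vertex_order ord -> vertex_order ord' -> path_choice hs -> path_choice hs' ->
    forall i j : int,
      lmod_iso (VCH Gamma n sqrtn ord hs i j) (VCH Gamma' n sqrtn ord' hs' i j))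
  /\
  (forall (ord : vertex G -> 'I_#|vertex G|) (hs : vertex G -> seq (half_edge G)),
    vertex_order ord -> path_choice hs ->
    (is_domain k ->
       vertex_poly Gamma n =
       euler_char (fun M : lmodType k => (rank M)%:R) (VCH Gamma n sqrtn ord hs))
    /\
    (forall dim : lmodType k -> rat, dimension_function dim ->
       vertex_poly Gamma n = euler_char dim (VCH Gamma n sqrtn ord hs))).
Proof.
move=> tri _ n_gt0 sqrtn2; split=> [G' Gamma' ord ord' hs hs'|ord hs ordP hsP].
  case=> fV [fH [fC [fS [[bV bH _ bS] [vertE oppE] fS1 corE bandE]]]].
  case: bV bH bS => gV fVK gVK [gH fHK gHK] [gS fSK gSK] ordP ordP' hsP hsP' i j.
  by apply: (@VCH_iso _ _ _ _ fV gV fH gH fC fS gS).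
have euler := vertex_poly_euler_char Gamma n_gt0 sqrtn2 tri ordP hsP.
by split=> [/rank_dimension_function/euler|].
Qed.
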